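(* Let $G$ be a countable group containing a nonabelian free subgroup and let $H$ be a nontrivial cyclic group. Then $\preccurlyeq_c^{G*H}\restriction\Gamma(G*H)$ is a universal countable Borel quasi-order, and hence $\preccurlyeq_c^{G*H}$ is a universal countable Borel quasi-order.
   Context: $G*H$ is the free product. For a countable group $K$, $\operatorname{Sg}(K)$ is the standard Borel space of subgroups of $K$ (a closed subset of $2^K$), and $\Gamma(K)$ is the Borel set of infinite subgroups. $\preccurlyeq_c^K$ is the quasi-order on $\operatorname{Sg}(K)$ given by $A\preccurlyeq_c^K B$ iff there exist $n\ge1$ and $g_1,\ldots,g_n\in K$ with $A=g_1Bg_1^{-1}\cap\cdots\cap g_nBg_n^{-1}$. A countable Borel quasi-order is a Borel quasi-order on a standard Borel space with countable predecessor sets; it is universal if every countable Borel quasi-order Borel reduces to it, where $Q\leq_B Q'$ means there is a Borel $f$ with $x\mathbin{Q}y\Leftrightarrow f(x)\mathbin{Q'}f(y)$. *)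

(* Defs.v *)
From HB Require Import structures.
From mathcomp Require Import all_boot all_order all_algebra.
From mathcomp Require Import all_classical all_reals all_analysis.

Set Implicit Arguments.
Unset Strict Implicit.
Unset Printing Implicit Defensive.

Local Open Scope group_scope.
Local Open Scope classical_set_scope.

(* The free product G * H is realised by its normal forms: words in the
   nontrivial elements of G and H whose consecutive letters come from different
   factors. *)
Section FreeProduct.
Variables G H : groupType.
Implicit Types (x y z : G + H) (u v w : seq (G + H)).

Definition nontrivial_letter x : bool :=
  match x with inl g => g != 1 | inr h => h != 1 end.

Definition alternating x y : bool :=
  match x, y with inl _, inr _ | inr _, inl _ => true | _, _ => false end.

Definition reduced_word w : bool :=
  all nontrivial_letter w && sorted alternating w.

#[local] Arguments reduced_word : simpl never.

Definition letter_inv x : G + H :=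
  match x with inl g => inl g^-1 | inr h => inr h^-1 end.

Definition letter_mul x y : option (G + H) :=
  match x, y with
  | inl g, inl g' => Some (inl (g * g'))
  | inr h, inr h' => Some (inr (h * h'))
  | _, _ => None
  end.

Definition push_letter x w := if nontrivial_letter x then x :: w else w.

(* The normal form of the product of the letter x and the normal form w. *)
Definition mul_letter x w :=
  if w is y :: w' then
    if letter_mul x y is Some z then push_letter z w' else push_letter x w
  else push_letter x w.

Definition mul_word u v := foldr mul_letter v u.

Definition inv_word w := rev (map letter_inv w).

Record free_product := FreeProduct
  { fp_word :> seq (G + H); fp_reduced : reduced_word fp_word }.

HB.instance Definition _ := [isSub for fp_word].
HB.instance Definition _ := [Choice of free_product by <:].

Lemma reduced_word_cons x w : reduced_word (x :: w) =
  [&& nontrivial_letter x, (if w is y :: _ then alternating x y else true)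
    & reduced_word w].
Proof.
rewrite /reduced_word; case: w => [|y w] /=; first by rewrite !andbT.
by case: nontrivial_letter; case: alternating; rewrite //= !andbF.
Qed.

Lemma mul_letter_reduced x w : reduced_word w -> reduced_word (mul_letter x w).
Proof.
case: w => [_|y w] /=.
  by rewrite /push_letter; case: ifP => // nx; rewrite reduced_word_cons nx.
move=> ryw; have := ryw; rewrite reduced_word_cons => /and3P[ny yw rw].
case e : letter_mul => [z|]; rewrite /push_letter; case: ifP => // nz.
  rewrite reduced_word_cons nz rw andbT /=.
  by case: x y z w e yw {ny rw ryw nz} => [g|g] [g'|g'] [k|k] [|[l|l] w].
by rewrite reduced_word_cons nz ryw andbT; case: x y e {nz ryw ny yw} => [g|g] [].
Qed.

Lemma mul_letter1 x w :
  ~~ nontrivial_letter x -> reduced_word w -> mul_letter x w = w.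
Proof.
case: w => [|y w] /=; first by rewrite /push_letter => /negbTE ->.
rewrite reduced_word_cons /push_letter => + /and3P[ny _ _].
by case: x y ny => [g|g] [g'|g'] //= ny; rewrite negbK => /eqP ->;
  rewrite ?mul1g ?ny ?eqxx.
Qed.

Lemma mul_letterA x y z w : letter_mul x y = Some z -> reduced_word w ->
  mul_letter x (mul_letter y w) = mul_letter z w.
Proof.
case: w => [|t w] /=.
  case: x y => [g|g] [g'|g'] //= [<-] _; rewrite /push_letter /=.
    by case: eqP => //= ->; rewrite mulg1.
  by case: eqP => //= ->; rewrite mulg1.
rewrite reduced_word_cons => + /and3P[nt + _].
case: x y t w nt => [g|g] [g'|g'] [k|k] [|[l|l] w] //= nt [<-] //= _.
all: rewrite /push_letter /=; try by case: ifP => /= [_|/negbFE/eqP ->];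
  rewrite ?mulgA ?mulg1 // nt.
all: try by case: ifP => /= [_|/negbFE/eqP e]; rewrite -?mulgA ?e ?mulg1.
Qed.

Lemma mul_letter_id x w : reduced_word (x :: w) -> mul_letter x w = x :: w.
Proof.
rewrite reduced_word_cons => /and3P[nx + _]; rewrite /mul_letter /push_letter.
by case: w => [|y w]; rewrite ?nx //; case: x y nx => [g|g] [g'|g'] //= ->.
Qed.

Lemma mul_word_reduced u v : reduced_word v -> reduced_word (mul_word u v).
Proof. by move=> rv; elim: u => //= x u; apply: mul_letter_reduced. Qed.

Lemma mul_word_letter x v w : reduced_word v -> reduced_word w ->
  mul_word (mul_letter x v) w = mul_letter x (mul_word v w).
Proof.
move=> rv rw; case: v rv => [_|y v] /=.
  by rewrite /push_letter; case: ifP => //= /negbT nx; rewrite mul_letter1.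
rewrite reduced_word_cons => /and3P[_ _ rv].
case e : letter_mul => [z|]; rewrite /push_letter; last first.
  case: ifP => //= /negbT nx; rewrite (mul_letter1 nx) //.
  by rewrite mul_letter_reduced // mul_word_reduced.
rewrite (mul_letterA e (mul_word_reduced v rw)).
by case: ifP => //= /negbT nz; rewrite mul_letter1 // mul_word_reduced.
Qed.

Lemma mul_wordA u v w : reduced_word v -> reduced_word w ->
  mul_word u (mul_word v w) = mul_word (mul_word u v) w.
Proof.
move=> rv rw; elim: u => //= x u ->.
by rewrite mul_word_letter // mul_word_reduced.
Qed.

Lemma mul_word1 w : reduced_word w -> mul_word w [::] = w.
Proof.
elim: w => //= x w IH rxw; rewrite IH ?mul_letter_id //.
by move: rxw; rewrite reduced_word_cons => /and3P[].
Qed.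

Lemma letter_invK : involutive letter_inv.
Proof. by case=> g /=; rewrite invgK. Qed.

Lemma inv_wordK : involutive inv_word.
Proof.
by move=> w; rewrite /inv_word map_rev revK -map_comp (eq_map letter_invK) map_id.
Qed.

Lemma inv_word_reduced w : reduced_word w -> reduced_word (inv_word w).
Proof.
rewrite /reduced_word /inv_word all_rev rev_sorted all_map sorted_map.
case/andP=> nw aw; apply/andP; split.
  by apply: sub_all nw => -[g|g] /=; rewrite invg_eq1.
by apply: sub_sorted aw => -[g|g] [g'|g'].
Qed.

Lemma mul_inv_word w : reduced_word w -> mul_word (inv_word w) w = [::].
Proof.
elim: w => // x w IH; rewrite reduced_word_cons => /and3P[_ _ rw].
have e : mul_letter (letter_inv x) (x :: w) = w.
  by case: x => g /=; rewrite mulVg /push_letter /= eqxx.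
rewrite /inv_word map_cons rev_cons -cats1 /mul_word foldr_cat.
by rewrite -[foldr _ _ [:: _]]/(mul_letter _ _) e; apply: IH.
Qed.

Definition fp_one : free_product := @FreeProduct [::] isT.
Definition fp_mul (a b : free_product) : free_product :=
  FreeProduct (mul_word_reduced a (fp_reduced b)).
Definition fp_inv (a : free_product) : free_product :=
  FreeProduct (inv_word_reduced (fp_reduced a)).

Lemma fp_mulA : associative fp_mul.
Proof. by move=> a b c; apply: val_inj; apply: mul_wordA; apply: fp_reduced. Qed.

Lemma fp_mul1 : left_id fp_one fp_mul.
Proof. by move=> a; apply: val_inj. Qed.

Lemma fp_mulr1 : right_id fp_one fp_mul.
Proof. by move=> a; apply: val_inj; apply: mul_word1; apply: fp_reduced. Qed.

Lemma fp_mulV : left_inverse fp_one fp_inv fp_mul.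
Proof. by move=> a; apply: val_inj; apply: mul_inv_word; apply: fp_reduced. Qed.

Lemma fp_mulVr : right_inverse fp_one fp_inv fp_mul.
Proof.
move=> a; rewrite -[X in fp_mul X _](_ : fp_inv (fp_inv a) = a) ?fp_mulV //.
by apply: val_inj; apply: inv_wordK.
Qed.

HB.instance Definition _ := isGroup.Build free_product
  fp_mulA fp_mul1 fp_mulr1 fp_mulV fp_mulVr.

End FreeProduct.

Section GroupProperties.
Variable G : groupType.

Definition nontrivial_group := exists x : G, x <> 1.

Definition cyclic_group :=
  exists h : G, forall x : G, exists n : nat, x = h ^+ n \/ x = h ^- n.

(* The letter (s, false) stands for s, and (s, true) for its inverse. *)
Definition freely_reduced (w : seq (G * bool)) : bool :=
  sorted (fun x y => ~~ ((x.1 == y.1) && (x.2 != y.2))) w.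

Definition word_value (w : seq (G * bool)) : G :=
  \prod_(x <- w) (if x.2 then x.1^-1 else x.1).

Definition reduced_words_over (S : set G) : set (seq (G * bool)) :=
  [set w | freely_reduced w /\ forall x, x \in w -> S x.1].

Definition free_subgroup (F : set G) :=
  group_closed (mem F) /\
  exists S : set G, set_bij (reduced_words_over S) F word_value.

Definition has_nonabelian_free_subgroup :=
  exists F : set G, free_subgroup F /\ ~ {in F &, forall x y, commute x y}.

End GroupProperties.

(* Measurable spaces are given by a carrier X and a sigma-algebra
   S : set (set X): the types of measurableType are pointed, which would
   exclude the empty space. *)
Section BorelSpaces.
Variable R : realType.

Definition borel_sets (T : topologicalType) : set (set T) := <<s open >>.

Definition polish (M : metricType R) :=
  (exists D : set M, countable D /\ dense D) /\
  forall F : set_system M, ProperFilter F -> cauchy F -> exists x : M, F --> x.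

Definition standard_borel (X : Type) (S : set (set X)) :=
  exists (M : metricType R) (f : X -> M),
    [/\ polish M, bijective f & S = preimage_set_system setT f (@borel_sets M)].

Definition product_algebra (X Y : Type) (S : set (set X)) (T : set (set Y)) :
    set (set (X * Y)) :=
  <<s preimage_set_system setT fst S `|` preimage_set_system setT snd T >>.

Definition borel_map (X Y : Type) (S : set (set X)) (T : set (set Y))
    (f : X -> Y) :=
  forall B, T B -> S (f @^-1` B).

Definition countable_borel_quasi_order (X : Type) (S : set (set X))
    (Q : X -> X -> Prop) :=
  [/\ standard_borel S,
      (forall x, Q x x),
      (forall x y z, Q x y -> Q y z -> Q x z),
      product_algebra S S [set p | Q p.1 p.2]
    & forall y, countable [set x | Q x y]].

Definition borel_reducible (X Y : Type) (S : set (set X)) (Q : X -> X -> Prop)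
    (T : set (set Y)) (Q' : Y -> Y -> Prop) :=
  exists f : X -> Y, borel_map S T f /\ forall x y, Q x y <-> Q' (f x) (f y).

Definition universal_countable_borel_quasi_order (Y : Type) (T : set (set Y))
    (Q' : Y -> Y -> Prop) :=
  countable_borel_quasi_order T Q' /\
  forall (X : Type) (S : set (set X)) (Q : X -> X -> Prop),
    countable_borel_quasi_order S Q -> borel_reducible S Q T Q'.

End BorelSpaces.

Section SubgroupSpace.
Variable K : groupType.

Definition Sg : set {ptws K -> bool} :=
  [set A | group_closed (A : K -> bool)].

(* Sg is used below as a type, with the subspace topology of 2^K. *)
Definition subgroup_set (A : Sg) : set K := [set x | (val A : K -> bool) x].

Definition infinite_subgroups : set Sg :=
  [set A | infinite_set (subgroup_set A)].

Definition conjugate_set (g : K) (B : set K) : set K :=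
  [set g * b * g^-1 | b in B].

Definition conj_le (A B : Sg) :=
  exists (n : nat) (g : 'I_n -> K), (1 <= n)%N /\
    subgroup_set A = \bigcap_i conjugate_set (g i) (subgroup_set B).

Definition borel_subgroups : set (set Sg) := @borel_sets Sg.

Definition borel_infinite_subgroups : set (set infinite_subgroups) :=
  preimage_set_system setT val borel_subgroups.

Definition conj_le_infinite (A B : infinite_subgroups) :=
  conj_le (val A) (val B).

End SubgroupSpace.

(* Main.v *)
Require Import Defs.
From HB Require Import structures.
From mathcomp Require Import all_boot all_order all_algebra.
From mathcomp Require Import all_classical all_reals all_analysis.
From mathcomp Require Import zify lra.

(* By the Lusin-Novikov theorem a countable Borel quasi-order Q may be assumed to live
   on the Baire space, with {u | u Q v} = {f_n v | n} for Borel functions f_n.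

   Free generators a, b of a free subgroup of G give a prefix code of positive words:
   letters a_n, one more letter c, and leaves. The set A_v of G consists of the words
   x d, where x is a path of letters and the leaf d records a value of the point
   reached from v along x; reading a_n applies f_n, and reading c leads to a sink at
   which every leaf is allowed. Then A_(f_n v) is the intersection of a_n^-1 A_v and
   c^-1 A_v. Conversely, if A_u is a finite intersection of translates of A_v, two
   marks present at every node force each translate to be based at a node, one of
   these nodes is not the sink, and its leaves show that its point is u.

   A subset A of G is turned into the subgroup H_A of G * H generated by the conjugates
   a H a^-1 with a in A; g H_A g^-1 = H_(g A), intersections are preserved, and a
   conjugate of H_B that contains H_A for some nonempty A is H_(g B) for some g in G. *)

Set Implicit Arguments.
Unset Strict Implicit.
Unset Printing Implicit Defensive.

Import Order.TTheory GRing.Theory Num.Theory.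

Local Open Scope classical_set_scope.

(** * Borel and analytic subsets of the Baire space *)

(** The obstacle is that the translate [a_n^-1 A_v] contains, besides [A_(f_n v)], every [a_n^-1 w]
    with [w] in [A_v] not beginning with [a_n]. The second translate removes these, because the
    codes of [a_n] and [c] end in different generators, and it removes nothing else, because the
    sink allows every leaf. The price is that a translate based at the sink carries no information.
    Since the value leaves at a point form the graph of that point, they never exhaust all leaves,
    so [A_u] is not an intersection of such translates alone. A node may lie several letters deep,
    which yields an iterate of the functions; transitivity keeps it below [v].

    In [G * H] the subgroup [H_A] is handled as the set of closed walks at 1, where a word moves
    through [G] and may read a letter of [H] only on [A]. Conjugation by a walk then changes the
    base point, and membership is tested on the normal form. *)

Section SigmaAlgebra.
Variables (T : Type) (S : set (set T)).
Hypothesis hS : sigma_algebra setT S.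

Lemma sigma_not (P : T -> Prop) : S [set x | P x] -> S [set x | ~ P x].
Proof.
by case: hS => _ C _ SP; rewrite -[X in S X]/(~` [set x | P x]) -setTD; exact: C.
Qed.

Lemma sigma_exists (I : countType) (P : I -> T -> Prop) :
  (forall i, S [set x | P i x]) -> S [set x | exists i, P i x].
Proof.
case: hS => S0 _ U SP.
pose A n := if @unpickle I n is Some i then [set x | P i x] else set0.
rewrite (_ : [set x | _] = \bigcup_n A n).
  by apply: U => n; rewrite /A; case: unpickle.
apply/seteqP; split=> x /=.
  by case=> i Pix; exists (pickle i) => //; rewrite /A pickleK.
by case=> n _; rewrite /A; case: unpickle => // i Pix; exists i.
Qed.

Lemma sigma_forall (I : countType) (P : I -> T -> Prop) :
  (forall i, S [set x | P i x]) -> S [set x | forall i, P i x].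
Proof.
move=> SP; rewrite (_ : [set x | _] = [set x | ~ exists i, ~ P i x]).
  by apply: sigma_not; apply: sigma_exists => i; apply: sigma_not.
by apply/seteqP; split=> x /=; rewrite -forallNE; move=> + i => /(_ i); rewrite notK.
Qed.

Lemma sigma_cst (P : Prop) : S [set _ | P].
Proof.
have S0 : S set0 by case: hS.
have [p|np] := pselect P.
  rewrite (_ : [set _ | P] = [set x : T | ~ set0 x]); first exact: sigma_not.
  by apply/seteqP; split=> x //= _ [].
by rewrite (_ : [set _ | P] = set0) //; apply/seteqP; split=> x.
Qed.

Lemma sigma_or (P Q : T -> Prop) :
  S [set x | P x] -> S [set x | Q x] -> S [set x | P x \/ Q x].
Proof.
move=> SP SQ.
rewrite (_ : [set x | _] = [set x | exists b : bool, (if b then P else Q) x]).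
  by apply: sigma_exists => -[].
by apply/seteqP; split=> x /=; [case; [exists true|exists false]|case=> -[]; tauto].
Qed.

Lemma sigma_and (P Q : T -> Prop) :
  S [set x | P x] -> S [set x | Q x] -> S [set x | P x /\ Q x].
Proof.
move=> SP SQ.
rewrite (_ : [set x | _] = [set x | ~ (~ P x \/ ~ Q x)]).
  by apply: sigma_not; apply: sigma_or; apply: sigma_not.
by apply/seteqP; split=> x /=; rewrite not_orE !notK.
Qed.

Lemma sigma_imp (P Q : T -> Prop) :
  S [set x | P x] -> S [set x | Q x] -> S [set x | P x -> Q x].
Proof.
move=> SP SQ; rewrite (_ : [set x | _] = [set x | ~ P x \/ Q x]).
  by apply: sigma_or => //; apply: sigma_not.
by apply/seteqP; split=> x /=; have [] := pselect (P x); tauto.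
Qed.

Lemma sigma_iff (P Q : T -> Prop) :
  S [set x | P x] -> S [set x | Q x] -> S [set x | P x <-> Q x].
Proof. by move=> SP SQ; apply: sigma_and; apply: sigma_imp. Qed.

End SigmaAlgebra.

Lemma sigma_algebra_preimages (T U : Type) (f : T -> U) (S : set (set T)) :
  sigma_algebra setT S -> sigma_algebra setT [set B | S (f @^-1` B)].
Proof.
move=> /(sigma_algebra_image f); rewrite /image_set_system.
by under eq_set do rewrite setTI.
Qed.

(** The sigma-algebra pulled back along [c] from the Baire space, given by generators so that Borel
    sets reduce to countable Boolean combinations of coordinate conditions. All standard Borel
    spaces below are brought to this form. *)
Definition borel_of (T : Type) (c : T -> nat -> nat) : set (set T) :=
  <<s [set A | exists k i, A = [set x | c x k = i]] >>.

Lemma borel_of_sigma T (c : T -> nat -> nat) : sigma_algebra setT (borel_of c).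
Proof. exact: smallest_sigma_algebra. Qed.
#[global] Hint Resolve borel_of_sigma : core.

Lemma borel_of_coord T (c : T -> nat -> nat) k i :
  borel_of c [set x | c x k = i].
Proof. by apply: sub_gen_smallest; exists k, i. Qed.

Lemma borel_of_sub T (c : T -> nat -> nat) (S : set (set T)) :
  sigma_algebra setT S -> (forall k i, S [set x | c x k = i]) ->
  borel_of c `<=` S.
Proof.
by move=> hS hc; apply: smallest_sub => // _ [k [i ->]].
Qed.

Definition baire := nat -> nat.

Notation borel := (borel_of (fun z : baire => z)).

Definition evens (z : baire) : baire := fun n => z n.*2.
Definition odds (z : baire) : baire := fun n => z n.*2.+1.
Definition interleave (x y : baire) : baire :=
  fun n => if odd n then y n./2 else x n./2.

Lemma evens_interleave x y : evens (interleave x y) = x.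
Proof. by apply/funext => n; rewrite /evens /interleave odd_double doubleK. Qed.

Lemma odds_interleave x y : odds (interleave x y) = y.
Proof.
by apply/funext => n; rewrite /odds /interleave /= odd_double /= uphalf_double.
Qed.

Lemma interleave_double x y n : interleave x y n.*2 = x n.
Proof. by rewrite /interleave odd_double doubleK. Qed.

Lemma interleave_doubleS x y n : interleave x y n.*2.+1 = y n.
Proof. by rewrite /interleave /= odd_double /= uphalf_double. Qed.

Lemma interleave_evens_odds z : interleave (evens z) (odds z) = z.
Proof.
apply/funext => n; rewrite /evens /odds /interleave -{4}(odd_double_half n).
by case: odd; rewrite ?add0n ?add1n.
Qed.

Definition borel_fun T (c : T -> nat -> nat) (f : T -> baire) :=
  forall k i, borel_of c [set x | f x k = i].

Lemma borel_fun_preimage T (c : T -> nat -> nat) (f : T -> baire) B :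
  borel_fun c f -> borel B -> borel_of c [set x | B (f x)].
Proof.
move=> hf bB; have h := sigma_algebra_preimages f (borel_of_sigma c).
by apply: (borel_of_sub h) bB => k i; apply: hf.
Qed.

Lemma borel_fun_evens : borel_fun (fun z : baire => z) evens.
Proof. by move=> k i; apply: borel_of_coord. Qed.

Lemma borel_fun_odds : borel_fun (fun z : baire => z) odds.
Proof. by move=> k i; apply: borel_of_coord. Qed.

Lemma borel_fun_comp T (c : T -> nat -> nat) (f : T -> baire) (g : baire -> baire) :
  borel_fun c f -> borel_fun (fun z : baire => z) g -> borel_fun c (g \o f).
Proof. by move=> hf hg k i; exact: (borel_fun_preimage hf (hg k i)). Qed.

Lemma borel_fun_interleave T (c : T -> nat -> nat) (f g : T -> baire) :
  borel_fun c f -> borel_fun c g -> borel_fun c (fun x => interleave (f x) (g x)).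
Proof. by move=> hf hg k i; rewrite /interleave; case: odd. Qed.

Lemma borel_fun_eq T (c : T -> nat -> nat) (f g : T -> baire) :
  borel_fun c f -> borel_fun c g -> borel_of c [set x | f x = g x].
Proof.
move=> hf hg; rewrite (_ : [set x | _] =
    [set x | forall k, exists i, f x k = i /\ g x k = i]).
  apply: (sigma_forall (borel_of_sigma c)) => k.
  apply: (sigma_exists (borel_of_sigma c)) => i.
  by apply: (sigma_and (borel_of_sigma c)).
apply/seteqP; split=> x /=; first by move=> -> k; exists (g x k).
by move=> e; apply/funext => k; have [i [-> ->]] := e k.
Qed.

(** The traces of Borel sets form a sigma-algebra containing the generators; this moves Borel sets
    of a coded space to the Baire space. *)
Lemma borel_of_trace T (c : T -> nat -> nat) A :
  borel_of c A -> exists2 B, borel B & A = [set x | B (c x)].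
Proof.
pose S := [set A | exists2 B, borel B & A = [set x | B (c x)]].
apply: (@borel_of_sub _ _ S); last first.
  by move=> k i; exists [set z | z k = i] => //; apply: borel_of_coord.
split=> /=.
- by exists set0 => //; case: (borel_of_sigma (fun z : baire => z)).
- move=> _ [B bB ->]; exists [set z | ~ B z]; first exact: (sigma_not (borel_of_sigma _)).
  by rewrite setTD.
- move=> F hF; have /choice[B hB] : forall n, exists B, borel B /\ F n = [set x | B (c x)].
    by move=> n; case: (hF n) => B; exists B.
  exists [set z | exists n, B n z].
    by apply: (sigma_exists (borel_of_sigma _)) => n; case: (hB n).
  apply/seteqP; split=> x /=.
    by case=> n _; case: (hB n) => _ ->; exists n.
  by case=> n Bn; exists n => //; case: (hB n) => _ ->.
Qed.

(** * Closed and analytic sets *)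

Definition agree n (y z : baire) := forall i, (i < n)%N -> y i = z i.

Definition baire_closed (F : set baire) :=
  forall z, (forall n, exists2 y, F y & agree n y z) -> F z.

Definition analytic (A : set baire) :=
  exists2 F, baire_closed F & forall x, A x <-> exists w, F (interleave x w).

Lemma ltn_bigmax_succ (h : nat -> nat) n i : (i < n)%N ->
  (h i < (\max_(j < n) h j).+1)%N.
Proof. by move=> ltin; rewrite ltnS (leq_bigmax (Ordinal ltin)). Qed.

Lemma closed_reindex (h : nat -> nat) F :
  baire_closed F -> baire_closed [set z : baire | F (z \o h)].
Proof.
move=> cF z hz; apply: cF => n; have [y Fy yz] := hz (\max_(j < n) h j).+1.
by exists (y \o h) => // i ltin; apply: yz; exact: ltn_bigmax_succ.
Qed.

Lemma closed_coord (A : set nat) k : baire_closed [set z : baire | A (z k)].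
Proof. by move=> z /(_ k.+1)[y Ay yz]; rewrite /= -yz. Qed.

Lemma closed_forall I (F : I -> set baire) :
  (forall i, baire_closed (F i)) -> baire_closed [set z | forall i, F i z].
Proof.
by move=> cF z hz i; apply: cF => n; have [y Fy yz] := hz n; exists y.
Qed.

Lemma closed_and (F F' : set baire) : baire_closed F -> baire_closed F' ->
  baire_closed [set z | F z /\ F' z].
Proof.
by move=> cF cF' z hz; split; [apply: cF|apply: cF'] => n;
  have [y [Fy Fy'] yz] := hz n; exists y.
Qed.

Lemma analytic_coord (A : set nat) k : analytic [set z : baire | A (z k)].
Proof.
exists [set z : baire | A (z k.*2)]; first exact: closed_coord.
move=> x; rewrite /interleave /= odd_double doubleK.
by split=> [Ax|[]]; first exists x.
Qed.

(* The union reads the index off the first entry of the witness. *)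
Lemma analytic_exists (A : nat -> set baire) :
  (forall n, analytic (A n)) -> analytic [set z | exists n, A n z].
Proof.
move=> aA; have /choice[F hF] : forall n, exists F, baire_closed F /\
    forall x, A n x <-> exists w, F (interleave x w).
  by move=> n; case: (aA n) => F; exists F.
pose tail z := interleave (evens z) (fun n => odds z n.+1).
exists [set z : baire | F (z 1%N) (tail z)].
  move=> z hz; case: (hF (z 1%N)) => cF _; apply: cF => n.
  have [y Fy yz] := hz n.+2; exists (tail y); first by rewrite -(yz 1%N).
  move=> i ltin; rewrite /tail /interleave /evens /odds.
  by case: ifP => oi; apply: yz; lia.
move=> x /=; split=> [[n]|[w]].
  case: (hF n) => _ -> [w Fw].
  exists (fun k => if k is k'.+1 then w k' else n).
  by rewrite /tail evens_interleave odds_interleave.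
rewrite /tail evens_interleave odds_interleave => Fw.
by exists (w 0%N); case: (hF (w 0%N)) => _ ->; exists (fun n => w n.+1).
Qed.

Lemma analytic_forall (A : nat -> set baire) :
  (forall n, analytic (A n)) -> analytic [set z | forall n, A n z].
Proof.
move=> aA; have /choice[F hF] : forall n, exists F, baire_closed F /\
    forall x, A n x <-> exists w, F (interleave x w).
  by move=> n; case: (aA n) => F; exists F.
(* One witness stores a whole sequence of witnesses, the [n]-th at the positions [pickle (n, k)];
   [h n] keeps the point and extracts that witness. *)
pose h (n k : nat) := if odd k then (pickle (n, k./2)).*2.+1 else k.
have hE n x (w : baire) : interleave x w \o h n = interleave x (fun k => w (pickle (n, k))).
  apply/funext => k; rewrite /h /interleave /=; case ok: (odd k); last by rewrite ok.
  by rewrite /= odd_double /= uphalf_double.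
exists [set z : baire | forall n, F n (z \o h n)].
  by apply: closed_forall => n; apply: closed_reindex; case: (hF n).
move=> x /=; split=> [Ax|[w Fw] n].
  have /choice[w Fw] : forall n, exists w, F n (interleave x w).
    by move=> n; case: (hF n) => _ <-.
  exists (fun m => if unpickle m is Some (n, k) then w n k else 0%N) => n.
  by rewrite hE; under eq_fun do rewrite pickleK.
by case: (hF n) => _ ->; exists (fun k => w (pickle (n, k))); rewrite -hE.
Qed.

Lemma analytic_and (A A' : set baire) : analytic A -> analytic A' ->
  analytic [set z | A z /\ A' z].
Proof.
move=> aA aA'; rewrite (_ : [set z | _] =
    [set z | forall n, (if n == 0%N then A else A') z]).
  by apply: analytic_forall => n; case: eqP.
apply/seteqP; split=> z /=; first by case=> Az A'z n; case: eqP.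
by move=> h; split; [exact: (h 0%N)|exact: (h 1%N)].
Qed.

Lemma analytic_reindex (h : nat -> nat) A :
  analytic A -> analytic [set z : baire | A (z \o h)].
Proof.
case=> F cF hF; pose h' k := if odd k then k else (h k./2).*2.
exists [set z : baire | F (z \o h')]; first exact: closed_reindex.
move=> x /=; have e w : interleave x w \o h' = interleave (x \o h) w.
  apply/funext => k; rewrite /interleave /h' /=; case ok: (odd k); first by rewrite ok.
  by rewrite odd_double doubleK.
by rewrite hF; split=> -[w]; exists w; [rewrite e|rewrite -e].
Qed.

Lemma analytic_proj A :
  analytic A -> analytic [set x | exists y, A (interleave x y)].
Proof.
case=> F cF hF.
(* [h] regroups the triple from [x, (y, w)] to [(x, y), w]. In the last case [k./2] is even, hence
   already twice an index into [x]. *)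
pose h k := if odd k then (k./2).*2.+1.*2.+1
            else if odd k./2 then (k./2./2).*2.*2.+1 else k./2.
have hE x y w : interleave x (interleave y w) \o h =
    interleave (interleave x y) w.
  apply/funext => k; rewrite /h [RHS]/interleave /=; case: (odd k).
    by rewrite !interleave_doubleS.
  case o: (odd k./2); first by rewrite interleave_doubleS interleave_double /interleave o.
  by rewrite /interleave o.
exists [set z : baire | F (z \o h)]; first exact: closed_reindex.
move=> x /=; split=> [[y]|[w]].
  by rewrite hF => -[w Fw]; exists (interleave y w); rewrite hE.
rewrite -(interleave_evens_odds w) hE => Fw.
by exists (evens w); rewrite hF; exists (odds w).
Qed.

(** Analytic sets are not closed under complements, so the induction runs over the sets that are
    analytic together with their complement. *)
Lemma borel_analytic A : borel A -> analytic A.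
Proof.
pose S : set (set baire) := [set A | analytic A /\ analytic [set z | ~ A z]].
suff: borel `<=` S by move=> h /h[].
have aF (P : Prop) : analytic [set _ | P].
  by exists [set _ | P] => [z /(_ 0%N)[]//|x]; split=> // [p|[]//]; exists x.
apply: borel_of_sub => [|k i]; last first.
  by split; [apply: (analytic_coord [set j | j = i])|
             apply: (analytic_coord [set j | j <> i])].
split=> /=.
- by split; [exact: aF|rewrite (_ : [set _ | _] = [set _ | True]) //;
    apply/seteqP; split=> z //= _ []].
- move=> B [aB aB']; rewrite setTD; split=> //.
  by rewrite (_ : [set _ | _] = B) //; apply/seteqP; split=> z /=; rewrite /setC /= notK.
- move=> B hB; split.
    rewrite (_ : \bigcup_i B i = [set z | exists n, B n z]).
      by apply: analytic_exists => n; case: (hB n).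
    by apply/seteqP; split=> z [n]; [exists n|exists n].
  rewrite (_ : [set _ | _] = [set z | forall n, ~ B n z]).
    by apply: analytic_forall => n; case: (hB n).
  by apply/seteqP; split=> z /= h; [move=> n Bn; apply: h; exists n|case=> n _; exact: h].
Qed.

Definition extends (s : seq nat) (z : baire) := agree (size s) z (nth 0%N s).

Lemma extends_rcons s z : extends s z -> extends (rcons s (z (size s))) z.
Proof.
move=> sz i; rewrite size_rcons ltnS nth_rcons leq_eqVlt.
by case: eqP => [-> _|_ /= h]; [rewrite ltnn|rewrite h; exact: sz].
Qed.

Lemma extends_mkseq n (y z : baire) : extends (mkseq z n) y <-> agree n y z.
Proof.
by rewrite /extends size_mkseq; split=> h i lin; rewrite h // nth_mkseq.
Qed.

Section Separation.

Let sep (P P' : set baire) :=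
  exists2 D, borel D & P `<=` D /\ forall x, D x -> ~ P' x.

(** The prefix constrains the point and its witness together, so that an infinite chain of prefixes
    determines both. *)
Let part (F : set baire) s : set baire :=
  [set x | exists w, F (interleave x w) /\ extends s (interleave x w)].

Let part_rcons F s x : part F s x -> exists a, part F (rcons s a) x.
Proof.
move=> [w [Fw sw]]; exists (interleave x w (size s)); exists w; split=> //.
exact: extends_rcons.
Qed.

Let sep_rcons F F' s t :
  (forall a b, sep (part F (rcons s a)) (part F' (rcons t b))) ->
  sep (part F s) (part F' t).
Proof.
move=> h; have /choice[D hD] : forall p : nat * nat, exists D, borel D /\
    part F (rcons s p.1) `<=` D /\ forall x, D x -> ~ part F' (rcons t p.2) x.
  by move=> p; case: (h p.1 p.2) => D; exists D.
exists [set x | exists a, forall b, D (a, b) x].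
  apply: (sigma_exists (borel_of_sigma _)) => a.
  by apply: (sigma_forall (borel_of_sigma _)) => b; case: (hD (a, b)).
split=> [x /part_rcons[a pa]|x [a Da] /part_rcons[b pb]].
  by exists a => b; case: (hD (a, b)) => _ [+ _]; apply.
by case: (hD (a, b)) => _ [_ /(_ x (Da b))].
Qed.

(* If the two sets could not be separated, neither could some pair of pieces
   cut out by longer and longer prefixes; the limits of the prefixes would give
   two distinct points, which a cylinder separates. *)
Lemma lusin_separation A A' : analytic A -> analytic A' ->
  (forall x, A x -> ~ A' x) ->
  exists2 D, borel D & A `<=` D /\ forall x, D x -> ~ A' x.
Proof.
case=> F cF hF [F' cF' hF'] dis; apply: contrapT => nsep.
have nsep0 : ~ sep (part F [::]) (part F' [::]).
  move=> [D bD [AD DA']]; apply: nsep; exists D => //; split=> [x|x /DA' h].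
    by rewrite hF => -[w Fw]; apply: AD; exists w.
  by rewrite hF' => -[w Fw]; apply: h; exists w.
have /choice[f hf] : forall p : seq nat * seq nat, exists ab : nat * nat,
    ~ sep (part F p.1) (part F' p.2) ->
    ~ sep (part F (rcons p.1 ab.1)) (part F' (rcons p.2 ab.2)).
  move=> p; have [h|h] := pselect (sep (part F p.1) (part F' p.2)).
    by exists (0%N, 0%N).
  apply: contrapT => nex; apply: h; apply: sep_rcons => a b.
  by apply: contrapT => nab; apply: nex; exists (a, b).
pose st := fix st n := if n is n'.+1
  then (rcons (st n').1 (f (st n')).1, rcons (st n').2 (f (st n')).2)
  else ([::], [::]).
have nst n : ~ sep (part F (st n).1) (part F' (st n).2).
  by elim: n => //= n IH; apply: hf.
pose z n := (f (st n)).1; pose z' n := (f (st n)).2.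
have stE n : st n = (mkseq z n, mkseq z' n).
  by elim: n => // n IH; rewrite !mkseqS /= /z /z' IH.
(* An empty piece is separated from anything, so the pieces met along [st] are nonempty, and
   closedness puts the limits into [F] and [F']. *)
have sep0 P P' : (forall x, ~ P x) \/ (forall x, ~ P' x) -> sep P P'.
  by case=> h; [exists [set _ | False]|exists [set _ | True]];
    try exact: (sigma_cst (borel_of_sigma _)); split=> // x /h.
have Fz : F z.
  apply: cF => n; apply: contrapT => nF; apply: (nst n); apply: sep0; left=> x.
  rewrite stE /= => -[w [Fw /extends_mkseq aw]]; apply: nF.
  by exists (interleave x w).
have Fz' : F' z'.
  apply: cF' => n; apply: contrapT => nF; apply: (nst n); apply: sep0; right=> x.
  rewrite stE /= => -[w [Fw /extends_mkseq aw]]; apply: nF.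
  by exists (interleave x w).
have [k nk] : exists k, evens z k <> evens z' k.
  apply: contrapT => /forallNP h; apply: (dis (evens z)).
    by rewrite hF; exists (odds z); rewrite interleave_evens_odds.
  rewrite (_ : evens z = evens z'); last by apply/funext => k; apply: contrapT.
  by rewrite hF'; exists (odds z'); rewrite interleave_evens_odds.
(* Coordinate [k] of the point sits at position [k.*2], so [k.*2.+1] is the first length at which
   the prefix shows it. *)
apply: (nst k.*2.+1); exists [set x : baire | x k = z k.*2].
  exact: borel_of_coord.
rewrite stE; split=> x /=.
  by move=> [w [_ /extends_mkseq/(_ k.*2 (ltnSn _))]]; rewrite interleave_double.
move=> xk [w [_ /extends_mkseq/(_ k.*2 (ltnSn _))]].
by rewrite interleave_double xk.
Qed.

End Separation.

(** The points with [y k = a] and those with [y k <> a] project to disjoint analytic sets, and Borel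
    sets separating them decide [y k] on the domain. Off the domain several separating sets, or
    none, may contain [x]: hence the least value, with default 0. *)
Lemma analytic_graph_borel_fun (D : set baire) :
  analytic D ->
  (forall x y y', D (interleave x y) -> D (interleave x y') -> y = y') ->
  exists2 g : baire -> baire, borel_fun (fun z => z) g &
    forall x y, D (interleave x y) -> y = g x.
Proof.
move=> aD uD.
pose P k (A : set nat) : set baire :=
  [set x | exists y, D (interleave x y) /\ A (y k)].
have aP k A : analytic (P k A).
  rewrite (_ : P k A = [set x | exists y,
      [set z | D z /\ [set z | A (z k.*2.+1)] z] (interleave x y)]).
    by apply: analytic_proj; apply: analytic_and => //; apply: analytic_coord.
  by apply/seteqP; split=> x [y h]; exists y; move: h; rewrite /= interleave_doubleS.
have /choice[E hE] : forall p : nat * nat, exists E, borel E /\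
    P p.1 [set p.2] `<=` E /\ forall x, E x -> ~ P p.1 (~` [set p.2]) x.
  move=> [k a] /=; have [] := @lusin_separation (P k [set a]) (P k (~` [set a])).
  - exact: aP.
  - exact: aP.
  - by move=> x [y [Dy ya]] [y' [Dy' y'a]]; apply: y'a; rewrite -(uD _ _ _ Dy Dy').
  - by move=> E; exists E.
pose least k x a := E (k, a) x /\ (forall a', ~ ((a' < a)%N /\ E (k, a') x)) \/
  a = 0%N /\ forall a', ~ E (k, a') x.
have least_ex (p : baire * nat) : exists a, least p.2 p.1 a.
  case: p => x k /=; have [[a Ea]|nE] := pselect (exists a, E (k, a) x); last first.
    by exists 0%N; right; split=> // a Ea; apply: nE; exists a.
  have ex : exists a, `[< E (k, a) x >] by exists a; apply/asboolP.
  case: (ex_minnP ex) => m /asboolP Em min; exists m; left; split=> // a' [lt /asboolP].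
  by move=> /min; rewrite leqNgt lt.
have least_uniq x k a a' : least k x a -> least k x a' -> a = a'.
  case=> [[Ea mina]|[-> nE]] [[Ea' mina']|[-> nE']] //.
  - case: (ltngtP a a') => // lt; first by case: (mina' a).
    by case: (mina a').
  - by case: (nE' a).
  - by case: (nE a').
have [g gP] := choice least_ex.
exists (fun x k => g (x, k)) => [k i|x y Dxy].
  rewrite (_ : [set x | _] = [set x | least k x i]).
    apply: (sigma_or (borel_of_sigma _)).
      apply: (sigma_and (borel_of_sigma _)); first by case: (hE (k, i)).
      apply: (sigma_forall (borel_of_sigma _)) => a.
      apply: (sigma_not (borel_of_sigma _)).
      apply: (sigma_and (borel_of_sigma _)); first exact: (sigma_cst (borel_of_sigma _)).
      by case: (hE (k, a)).
    apply: (sigma_and (borel_of_sigma _)); first exact: (sigma_cst (borel_of_sigma _)).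
    apply: (sigma_forall (borel_of_sigma _)) => a.
    by apply: (sigma_not (borel_of_sigma _)); case: (hE (k, a)).
  apply/seteqP; split=> x /=; first by move=> <-; apply: (gP (x, k)).
  by move=> l; apply: least_uniq l; apply: (gP (x, k)).
apply/funext => k; apply: (@least_uniq x k); last exact: (gP (x, k)).
left; split; first by case: (hE (k, y k)) => _ [+ _]; apply; exists y.
move=> a [lt Ea]; case: (hE (k, a)) => _ [_ /(_ x Ea)]; apply; exists y.
by split=> //= ya; rewrite ya ltnn in lt.
Qed.

(** * Sets with countable sections *)

Section CountableSections.
Variable F : set baire.
Hypothesis closedF : baire_closed F.

Let X (c : baire) := evens (evens c).
Let Y (c : baire) := odds (evens c).

Let piece s (x y : baire) := exists c, [/\ F c, extends s c, X c = x & Y c = y].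

Let covered (g : nat -> baire -> baire) x y := exists n, y = g n x.

(** Which member of [L] is covered may depend on [x]. A family that is not small therefore has all
    its pieces nonempty above one common [x]. *)
Let small (L : seq (seq nat)) :=
  exists2 g : nat -> baire -> baire, (forall n, borel_fun (fun z => z) (g n)) &
    forall x, exists2 s, s \in L & forall y, piece s x y -> covered g x y.

Let smallS L L' : {subset L <= L'} -> small L -> small L'.
Proof.
move=> LL' [g bg hg]; exists g => // x.
by have [s sL hs] := hg x; exists s => //; apply: LL'.
Qed.

Let not_small_point L :
  ~ small L -> exists x, forall s, s \in L -> exists y, piece s x y.
Proof.
move=> nL; apply: contrapT => /forallNP h; apply: nL.
exists (fun _ z => z) => [_ k i|x]; first exact: borel_of_coord.
have /existsNP[s /not_implyP[sL ns]] := h x.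
by exists s => // y py; case: ns; exists y.
Qed.

Let splits s s1 s2 :=
  [/\ (size s < size s1)%N, (size s < size s2)%N,
      (forall z, extends s1 z -> extends s z),
      (forall z, extends s2 z -> extends s z) &
      exists k, forall c1 c2, extends s1 c1 -> extends s2 c2 -> Y c1 k <> Y c2 k].

Let analytic_piece s : analytic [set z | piece s (evens z) (odds z)].
Proof.
exists [set c | F c /\ extends s c].
  apply: closed_and => // c hc i lti.
  by have [c' ext agr] := hc (size s); rewrite -agr // ext.
move=> z; split=> [[c [Fc sc Xc Yc]]|[w [Fw sw]]].
  exists (odds c); rewrite (_ : interleave z (odds c) = c) //.
  rewrite -[RHS]interleave_evens_odds -(interleave_evens_odds (evens c)).
  by rewrite -/(X c) Xc -/(Y c) Yc interleave_evens_odds.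
by exists (interleave z w); rewrite /X /Y evens_interleave.
Qed.

Let borel_covered g : (forall n, borel_fun (fun z => z) (g n)) ->
  borel [set z | covered g (evens z) (odds z)].
Proof.
move=> bg; apply: (sigma_exists (borel_of_sigma _)) => n.
apply: borel_fun_eq; first exact: borel_fun_odds.
exact: (borel_fun_comp borel_fun_evens (bg n)).
Qed.

(* If every such pair gave a small family, then away from the countably many
   graphs witnessing this the piece of s would have at most one point above each
   x, so that one more Borel graph would cover it. *)
Let not_small_split s L : ~ small (s :: L) ->
  exists p : seq nat * seq nat, splits s p.1 p.2 /\ ~ small [:: p.1, p.2 & L].
Proof.
move=> nsm; apply: contrapT => nex.
have /choice[g hg] : forall p : seq nat * seq nat,
    exists g : nat -> baire -> baire, (forall n, borel_fun (fun z => z) (g n)) /\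
    (splits s p.1 p.2 -> forall x, exists2 t, t \in [:: p.1, p.2 & L] &
      forall y, piece t x y -> covered g x y).
  move=> p; have [sp|nsp] := pselect (splits s p.1 p.2); last first.
    by exists (fun _ z => z); split=> // _ k i; apply: borel_of_coord.
  apply: contrapT => ng; apply: nex; exists p; split=> // -[g bg hg].
  by apply: ng; exists g.
pose G m := if unpickle m is Some (p, n) then g p n else id.
have bG n : borel_fun (fun z => z) (G n).
  rewrite /G; case: unpickle => [[p m]|k i]; last exact: borel_of_coord.
  by case: (hg p).
have coverG p x y : covered (g p) x y -> covered G x y.
  by move=> [n ->]; exists (pickle (p, n)); rewrite /G pickleK.
pose uncov t x := exists y, piece t x y /\ ~ covered G x y.
have a_uncov_pair t :
    analytic [set z | piece t (evens z) (odds z) /\ ~ covered G (evens z) (odds z)].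
  apply: analytic_and; first exact: analytic_piece.
  apply: borel_analytic; apply: (sigma_not (borel_of_sigma _)).
  exact: borel_covered.
have a_uncov t : analytic [set z | uncov t (evens z)].
  apply: (@analytic_reindex double [set x | uncov t x]).
  rewrite (_ : [set x | _] = [set x | exists y, [set z | piece t (evens z) (odds z) /\
     ~ covered G (evens z) (odds z)] (interleave x y)]).
    exact: analytic_proj.
  by apply/seteqP; split=> x [y] h; exists y; move: h;
    rewrite /= evens_interleave odds_interleave.
(* The last clause keeps only those [x] above which no other member of [L] is covered; in [uD] it
   excludes the case that [hg] covers a piece from [L]. *)
pose D : set baire := [set z | (piece s (evens z) (odds z) /\
   ~ covered G (evens z) (odds z)) /\ forall t, t \in L -> uncov t (evens z)].
have aL : analytic [set z | forall t, t \in L -> uncov t (evens z)].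
  rewrite (_ : [set z | _] = [set z | forall i,
      (if (i < size L)%N then [set z | uncov (nth [::] L i) (evens z)] else setT) z]).
    apply: analytic_forall => i; case: ifP => _; first exact: a_uncov.
    rewrite -[setT]/[set _ | True]; apply: borel_analytic.
    exact: (sigma_cst (borel_of_sigma _)).
  apply/seteqP; split=> z /= h.
    by move=> i; case: ifP => // lti; apply: h; apply: mem_nth.
  move=> t tL; have := h (index t L); rewrite index_mem tL /=.
  by rewrite nth_index // => /(_ isT).
have aD : analytic D by exact: (analytic_and (a_uncov_pair s) aL).
have uD x y y' : D (interleave x y) -> D (interleave x y') -> y = y'.
  rewrite /D /= !evens_interleave !odds_interleave.
  move=> [[py ny] hL] [[py' ny'] _]; apply: contrapT => neq.
  have [k nk] : exists k, y k <> y' k.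
    by apply: contrapT => /forallNP h; apply: neq; apply/funext => k; apply: contrapT.
  case: py py' => [c [Fc sc Xc Yc]] [c' [Fc' sc' Xc' Yc']].
  (* Long enough to extend [s] properly and to show [Y] at [k], which is entry [k.*2.+1.*2] of the
     code. *)
  pose n := maxn (size s).+1 (k.*2.+1.*2).+1.
  have ext : splits s (mkseq c n) (mkseq c' n).
    split; rewrite ?size_mkseq ?leq_maxl //.
    - move=> z /extends_mkseq zc i lti; rewrite -sc // zc //.
      by rewrite leq_max ltnS ltnW.
    - move=> z /extends_mkseq zc i lti; rewrite -sc' // zc //.
      by rewrite leq_max ltnS ltnW.
    exists k => c1 c2 /extends_mkseq e1 /extends_mkseq e2.
    rewrite /Y /odds /evens e1 ?leq_maxr // e2 ?leq_maxr // => e.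
    by apply: nk; rewrite -Yc -Yc'.
  case: (hg (mkseq c n, mkseq c' n)) => _ /(_ ext x)[t] /=.
  rewrite !inE => /or3P[/eqP->|/eqP->|tL] ht.
  - apply: ny; apply: coverG; apply: ht; exists c; split=> //.
    by apply/extends_mkseq.
  - apply: ny'; apply: coverG; apply: ht; exists c'; split=> //.
    by apply/extends_mkseq.
  - by have [y'' [py'']] := hL t tL; apply; apply: coverG; apply: ht.
have [g0 bg0 hg0] := analytic_graph_borel_fun aD uD.
apply: nsm; exists (fun n => if n is n'.+1 then G n' else g0) => [[|n]//|x].
pose G' n := if n is n'.+1 then G n' else g0.
have coverG' y : covered G x y -> covered G' x y by move=> [n ->]; exists n.+1.
have [[t tL ht]|nt] := pselect (exists2 t, t \in L & ~ uncov t x).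
  exists t; first by rewrite inE tL orbT.
  move=> y py; apply: coverG'; apply: contrapT => nc; apply: ht.
  by exists y.
exists s; first by rewrite inE eqxx.
move=> y py; have [|nc] := pselect (covered G x y); first exact: coverG'.
exists 0%N; apply: hg0; rewrite /D /= evens_interleave odds_interleave.
by split=> // t tL; apply: contrapT => ht; apply: nt; exists t.
Qed.

(* A queue of prefixes: the head is split and its two children are appended, so
   that the j-th head has the (2j+1)-th and (2j+2)-th heads as children and every
   level of the resulting binary tree is at some time contained in the queue. *)
Let not_small_tree : ~ small [:: [::]] -> exists T : nat -> seq nat,
  (forall j, splits (T j) (T j.*2.+1) (T j.*2.+2)) /\
  forall j, exists x, forall i, (i <= j)%N -> exists y, piece (T (j + i)%N) x y.
Proof.
move=> nsm0.
have /choice[next hnext] : forall L, exists p : seq nat * seq nat,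
    ~ small L -> L != [::] ->
    splits (head [::] L) p.1 p.2 /\ ~ small [:: p.1, p.2 & behead L].
  case=> [|s L]; first by exists ([::], [::]).
  have [sm|/not_small_split[p hp]] := pselect (small (s :: L)).
    by exists ([::], [::]).
  by exists p.
pose st j := iter j
  (fun L => rcons (rcons (behead L) (next L).1) (next L).2) [:: [::]].
have size_st j : size (st j) = j.+1.
  by elim: j => //= j IH; rewrite !size_rcons size_behead IH.
have st_neq0 j : st j != [::] by rewrite -size_eq0 size_st.
have nsm j : ~ small (st j).
  elim: j => // j IH; case: (hnext _ IH (st_neq0 j)) => _ + /=.
  apply: contra_not; apply: smallS => t.
  by rewrite !(mem_rcons, inE) => /or3P[] ->; rewrite ?orbT.
pose T j := head [::] (st j).
have nth_st i j : (i <= j)%N -> nth [::] (st j) i = T (j + i)%N.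
  elim: i j => [|i IH] j lt; first by rewrite addn0 nth0.
  rewrite addnS -addSn -IH; last by lia.
  by rewrite /= !nth_rcons !size_rcons size_behead size_st /= lt ltnW // nth_behead.
exists T; split=> j.
  have -> : T j.*2.+1 = (next (st j)).1.
    rewrite -addnn -addSn -nth_st //= !nth_rcons !size_rcons size_behead size_st /=.
    by rewrite ltnSn ltnn eqxx.
  have -> : T j.*2.+2 = (next (st j)).2.
    rewrite -addnn -addSn -addnS -nth_st //= nth_rcons !size_rcons size_behead size_st /=.
    by rewrite ltnn eqxx.
  by case: (hnext _ (nsm j) (st_neq0 j)).
have [x hx] := not_small_point (nsm j).
exists x => i leij; apply: hx; rewrite -nth_st //; apply: mem_nth.
by rewrite size_st.
Qed.

Let node (a : nat -> bool) :=
  fix node k : nat := if k is k'.+1 then (node k').*2.+1 + a k' else 0%N.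

(** In this heap numbering level [k] occupies the indices from [2 ^ k - 1] to [2 ^ k.+1 - 2]. This
    is exactly the queue at time [2 ^ k - 1], so all pieces of one level are nonempty above a common
    point. *)
Let node_bounds a k : (2 ^ k <= (node a k).+1 < 2 ^ k.+1)%N.
Proof.
elim: k => //= k; rewrite !expnS => /andP[l u]; case: (a k); lia.
Qed.

(** Otherwise every bit sequence [a] gives a branch with limit [lim a] in [F]. Any two limits have
    the same [X], since at each level their prefixes extend to codes above a common point, and
    different [Y], since the branches split: a Cantor set inside a countable section. *)
Let small_countable :
  (forall x, countable [set y | exists c, [/\ F c, X c = x & Y c = y]]) ->
  small [:: [::]].
Proof.
move=> cF; apply: contrapT => /not_small_tree[T [Tsplit Tpt]].
have Tnext a k : splits (T (node a k)) (T (node a k).*2.+1) (T (node a k).*2.+2) by [].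
have Tsize a k : (k <= size (T (node a k)))%N.
  elim: k => //= k IH; apply: (leq_ltn_trans IH).
  by case: (Tnext a k) => s1 s2 _ _ _; case: (a k); rewrite ?addn1 ?addn0.
have Text a k z : extends (T (node a k.+1)) z -> extends (T (node a k)) z.
  by case: (Tnext a k) => _ _ e1 e2 _ /=; case: (a k); rewrite ?addn1 ?addn0; auto.
have Texts a k m z : (k <= m)%N -> extends (T (node a m)) z -> extends (T (node a k)) z.
  by move=> /subnKC <-; elim: (m - k)%N => [|i IH]; rewrite ?addn0 ?addnS // => /Text.
have Tpiece a b k : exists c c', [/\ F c /\ F c', extends (T (node a k)) c,
     extends (T (node b k)) c' & X c = X c'].
  have [x hx] := Tpt (2 ^ k).-1.
  have h d : exists y, piece (T (node d k)) x y.
    have := node_bounds d k; rewrite expnS => /andP[l u].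
    by rewrite (_ : node d k = ((2 ^ k).-1 + ((node d k).+1 - 2 ^ k))%N); [apply: hx|]; lia.
  have [_ [c [Fc ec Xc _]]] := h a; have [_ [c' [Fc' ec' Xc' _]]] := h b.
  by exists c, c'; rewrite Xc Xc'.
(* The prefix at level [i.+1] has at least [i.+1] entries, so entry [i] is never the default 0. *)
pose lim a : baire := fun i => nth 0%N (T (node a i.+1)) i.
have lim_agree a k c : extends (T (node a k)) c -> agree k c (lim a).
  move=> ec i lik.
  exact: (Texts a i.+1 k c lik ec i (Tsize a i.+1)).
have lim_ext a k : extends (T (node a k)) (lim a).
  have [m km] : exists m, (k <= m)%N /\ (size (T (node a k)) <= m)%N.
    by exists (k + size (T (node a k)))%N; lia.
  have [c [_ [[_ _] ec _ _]]] := Tpiece a a m.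
  case: km => km sm i lti; rewrite -(lim_agree a m c ec) ?(leq_trans lti) //.
  by apply: (Texts a k m).
have F_lim a : F (lim a).
  apply: closedF => n; have [c [_ [[Fc _] ec _ _]]] := Tpiece a a n.
  by exists c => //; exact: lim_agree.
have X_lim a b : X (lim a) = X (lim b).
  apply/funext => i; have [c [c' [_ ec ec' eX]]] := Tpiece a b (i.*2.*2).+1.
  rewrite /X /evens -(lim_agree _ _ _ ec) // -(lim_agree _ _ _ ec') //.
  by rewrite -[c _]/(X c i) eX.
have Y_lim_inj : injective (fun a => Y (lim a)).
  move=> a b eY; apply: contrapT => neq.
  have exk : exists k, a k != b k.
    by apply: contrapT => /forallNP h; apply: neq; apply/funext => k;
      apply/eqP; apply/negPn/negP.
  case: (ex_minnP exk) => k nab min.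
  have ab i : (i < k)%N -> a i = b i.
    by move=> lt; apply/eqP; apply/negPn/negP => /min; rewrite leqNgt lt.
  have nodeE : node a k = node b k.
    have : forall j, (j <= k)%N -> node a j = node b j; last by apply.
    by elim=> // j IH lt /=; rewrite IH ?ab // ltnW.
  case: (Tnext a k) => _ _ _ _ [l hl].
  have ea := lim_ext a k.+1; have eb := lim_ext b k.+1.
  move: ea eb nab; rewrite /= -nodeE; have := congr1 (fun y => y l) eY.
  case: (a k); case: (b k) => //= e; rewrite ?addn0 ?addn1 => ea eb _.
    exact: (hl _ _ eb ea).
  exact: (hl _ _ ea eb).
pose x := X (lim (fun _ => false)).
have /countable_injP[h hinj] := cF x.
have h2inj : injective (fun a => h (Y (lim a))).
  move=> a b /= e; apply: Y_lim_inj; apply: hinj => //=; rewrite inE /=.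
    by exists (lim a); split=> //; apply: X_lim.
  by exists (lim b); split=> //; apply: X_lim.
(* Cantor's diagonal: bit [n] of [d] is true exactly when the branch numbered [n] exists and has bit
   [n] false. *)
pose d n := `[< exists a, h (Y (lim a)) = n /\ a n = false >].
have [da|da] := boolP (d (h (Y (lim d)))).
  have /asboolP[a [/h2inj ea]] := da.
  by rewrite ea da.
move/negP: (da) => nd; apply: nd; apply/asboolP; exists d; split=> //.
exact: negbTE.
Qed.

Lemma closed_countable_sections :
  (forall x, countable [set y | exists w, F (interleave (interleave x y) w)]) ->
  exists2 g : nat -> baire -> baire, (forall n, borel_fun (fun z => z) (g n)) &
    forall x y w, F (interleave (interleave x y) w) -> exists n, y = g n x.
Proof.
move=> cF; have [x|g bg hg] := small_countable.
  apply: sub_countable (cF x); apply: subset_card_le => y /= [c [Fc Xc Yc]].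
  exists (odds c).
  by rewrite -Xc -Yc !interleave_evens_odds.
exists g => // x y w Fw; have [s] := hg x; rewrite inE => /eqP -> h.
apply: h; exists (interleave (interleave x y) w); split=> //.
  by rewrite /X !evens_interleave.
by rewrite /Y evens_interleave odds_interleave.
Qed.

End CountableSections.

(* Only the half of the Lusin-Novikov theorem that concerns total functions: the
   graphs cover the set, and no domain has to be shown Borel. *)
Lemma lusin_novikov (B : set baire) : analytic B ->
  (forall x, countable [set y | B (interleave x y)]) ->
  exists2 g : nat -> baire -> baire, (forall n, borel_fun (fun z => z) (g n)) &
    forall x y, B (interleave x y) -> exists n, y = g n x.
Proof.
case=> F cF hF cB; have [x|g bg hg] := closed_countable_sections cF.
  by apply: sub_countable (cB x); apply: subset_card_le => y /= ?; apply/hF.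
by exists g => // x y /hF[w Fw]; apply: hg Fw.
Qed.

(** * Standard Borel spaces *)


Lemma natSinv_small (R : realType) (e : R) : (0 < e)%R ->
  exists N, forall k, (N <= k)%N -> (k.+1%:R^-1 < e)%R.
Proof.
move=> e0; have [N _ hN] := near_infty_natSinv_lt (PosNum e0).
by exists N => k; apply: hN.
Qed.

Lemma borel_rel2 (P : nat -> nat -> Prop) k l :
  borel [set z | P (z k) (z l)].
Proof.
rewrite (_ : [set z | _] =
    [set z | exists i, exists j, [/\ z k = i, z l = j & P i j]]).
  apply: (sigma_exists (borel_of_sigma _)) => i.
  apply: (sigma_exists (borel_of_sigma _)) => j.
  rewrite (_ : [set z | _] = [set z | z k = i /\ (z l = j /\ P i j)]); last first.
    by apply/seteqP; split=> z /= => [[]|[? []]].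
  apply: (sigma_and (borel_of_sigma _)); first exact: borel_of_coord.
  apply: (sigma_and (borel_of_sigma _)); first exact: borel_of_coord.
  exact: (sigma_cst (borel_of_sigma _)).
apply/seteqP; split=> z /=; first by move=> Pz; exists (z k), (z l).
by move=> [i [j [-> ->]]].
Qed.

(** * Coding a Polish space in the Baire space *)

Section PolishCoding.
Variables (R : realType) (M : metricType R).
Hypothesis polishM : polish M.
Local Open Scope ring_scope.

Lemma polish_cvg (u : nat -> M) :
  (forall e : R, 0 < e -> exists N, forall k, (N <= k)%N -> mdist (u N) (u k) < e) ->
  exists x, forall e : R, 0 < e -> exists N, forall l, (N <= l)%N -> mdist x (u l) < e.
Proof.
move=> cu; case: polishM => _ /(_ (u @ \oo) _)[|x ux].
  apply/cauchyP => e e0; have [N hN] := cu e e0; exists (u N).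
  by exists N => // k /= Nk; rewrite ballEmdist; apply: hN.
exists x => e e0.
have /ux [N _ hN] := nbhsx_ballx x e e0.
by exists N => l Nl; have := hN l Nl; rewrite /= ballEmdist.
Qed.

Variable d : nat -> M.
Hypothesis d_dense : forall x (e : R), 0 < e -> exists i, mdist x (d i) < e.

Let r k : R := k.+1%:R^-1.
Let r_gt0 k : 0 < r k. Proof. by rewrite /r invr_gt0. Qed.

(** A point is coded by the least index of a dense point within [r k], for each [k]; leastness makes
    the code unique and its coordinate sets Boolean combinations of balls. *)
Let leastnear x k i := mdist x (d i) < r k /\
  forall j, (j < i)%N -> r k <= mdist x (d j).

Let leastnear_uniq x k i j : leastnear x k i -> leastnear x k j -> i = j.
Proof.
move=> [di ni] [dj nj]; case: (ltngtP i j) => // [/nj|/ni].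
  by rewrite leNgt di.
by rewrite leNgt dj.
Qed.

Let leastnear_ex x k : exists i, leastnear x k i.
Proof.
case: (ex_minnP (d_dense x (r_gt0 k))) => i di min; exists i; split=> // j ltji.
by rewrite leNgt; apply/negP => /min; rewrite leqNgt ltji.
Qed.

Let code (x : M) : baire := fun k => xget 0%N [set i | leastnear x k i].

Let codeP x k : leastnear x k (code x k).
Proof. by have [i hi] := leastnear_ex x k; apply: (xgetI 0%N hi). Qed.

Let code_near x k : mdist x (d (code x k)) < r k.
Proof. by case: (codeP x k). Qed.

Let code_inj : injective code.
Proof.
move=> x y e; apply: mdist_positivity; apply/eqP; rewrite eq_le mdist_ge0 andbT.
rewrite leNgt; apply/negP => lt.
have [N /(_ N (leqnn N)) hN] := natSinv_small (divr_gt0 lt (ltr0Sn _ 2)).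
have hx := code_near x N; have := code_near y N; rewrite -e metric_sym => hy.
have := metric_triangle x (d (code x N)) y; rewrite -/(r N) in hN.
by lra.
Qed.

(** An open set is the countable union of the sets [code x k = i] over the balls [ball (d i) (r k)]
    inside it, since each point lies in the balls named by its code. *)
Let code_borel (U : set M) : borel_sets U -> borel_of code U.
Proof.
apply: smallest_sub => // {}U oU.
rewrite (_ : U = [set x | exists k, exists i,
    (ball (d i) (r k) `<=` U) /\ code x k = i]).
  apply: (sigma_exists (borel_of_sigma _)) => k.
  apply: (sigma_exists (borel_of_sigma _)) => i.
  apply: (sigma_and (borel_of_sigma _)); last exact: borel_of_coord.
  exact: (sigma_cst (borel_of_sigma _)).
apply/seteqP; split=> x /=; last first.
  move=> [k [i [sub e]]]; apply: sub; rewrite ballEmdist /= metric_sym -e.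
  exact: code_near.
move=> Ux; have /nbhs_ballP[e /= e0 eU] := open_nbhs_nbhs (conj oU Ux).
have [N /(_ N (leqnn N)) hN] := natSinv_small (divr_gt0 e0 (ltr0Sn _ 1)).
exists N, (code x N); split=> // y; rewrite ballEmdist /= => hy; apply: eU.
have := metric_triangle x (d (code x N)) y; have := code_near x N.
by rewrite ballEmdist /= -/(r N) in hN *; lra.
Qed.

Let borel_code : borel_of code `<=` @borel_sets M.
Proof.
have hS : sigma_algebra setT (@borel_sets M) by apply: smallest_sigma_algebra.
have bball i k : borel_sets [set x | mdist x (d i) < r k].
  apply: sub_gen_smallest => /=; rewrite openE => x /= hx.
  apply/nbhs_ballP; exists (r k - mdist x (d i)) => /=; first by rewrite subr_gt0.
  move=> y; rewrite ballEmdist /=.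
  by have := metric_triangle y x (d i); rewrite (metric_sym y x); lra.
apply: borel_of_sub => // k i.
rewrite (_ : [set x | _] = [set x | mdist x (d i) < r k /\
    forall j, (j < i)%N -> ~ (mdist x (d j) < r k)]).
  apply: (sigma_and hS); first exact: bball.
  apply: (sigma_forall hS) => j; apply: (sigma_imp hS); first exact: sigma_cst.
  by apply: (sigma_not hS); apply: bball.
apply/seteqP; split=> x /=.
  by move=> <-; case: (codeP x k) => h1 h2; split=> // j /h2; rewrite leNgt => /negP.
move=> [h1 h2]; apply: (leastnear_uniq (codeP x k)); split=> // j /h2.
by rewrite leNgt => /negP.
Qed.

(* A sequence z codes a point iff d o z converges fast enough and its limit satisfies
   the inequalities of leastnear, stated here through the terms of d o z. *)
Let range_code : borel (range code).
Proof.
(* A strict inequality for the limit becomes an eventual gap [r m], a weak one eventual validity up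
   to every [r m]; each clause then compares only two entries at a time. *)
rewrite (_ : range code = [set z |
   (forall k l, mdist (d (z k)) (d (z l)) <= r k + r l) /\
   ((forall k, exists m L, forall l, (L <= l)%N ->
      mdist (d (z l)) (d (z k)) <= r k - r m) /\
    (forall k j m, exists L, forall l, (L <= l)%N -> (j < z k)%N ->
      r k - r m <= mdist (d (z l)) (d j)))]).
  apply: (sigma_and (borel_of_sigma _)).
    apply: (sigma_forall (borel_of_sigma _)) => k.
    apply: (sigma_forall (borel_of_sigma _)) => l.
    exact: (borel_rel2 (fun a b => mdist (d a) (d b) <= r k + r l)).
  apply: (sigma_and (borel_of_sigma _)).
    apply: (sigma_forall (borel_of_sigma _)) => k.
    apply: (sigma_exists (borel_of_sigma _)) => m.
    apply: (sigma_exists (borel_of_sigma _)) => L.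
    apply: (sigma_forall (borel_of_sigma _)) => l.
    apply: (sigma_imp (borel_of_sigma _)).
      exact: (sigma_cst (borel_of_sigma _)).
    exact: (borel_rel2 (fun a b => mdist (d a) (d b) <= r k - r m)).
  apply: (sigma_forall (borel_of_sigma _)) => k.
  apply: (sigma_forall (borel_of_sigma _)) => j.
  apply: (sigma_forall (borel_of_sigma _)) => m.
  apply: (sigma_exists (borel_of_sigma _)) => L.
  apply: (sigma_forall (borel_of_sigma _)) => l.
  apply: (sigma_imp (borel_of_sigma _)).
    exact: (sigma_cst (borel_of_sigma _)).
  exact: (borel_rel2 (fun a b => (j < a)%N -> r k - r m <= mdist (d b) (d j))).
apply/seteqP; split=> z /=.
  move=> [x _ <-]; split; [|split].
  - move=> k l; have := metric_triangle (d (code x k)) x (d (code x l)).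
    have := code_near x k; have := code_near x l.
    by rewrite (metric_sym (d (code x k)) x); lra.
  - move=> k; have hk := code_near x k.
    have e0 : 0 < (r k - mdist x (d (code x k))) / 2 by lra.
    have [N hN] := natSinv_small e0.
    exists N, N => l Nl; have := hN l Nl; have := hN N (leqnn N).
    rewrite -/(r l) -/(r N); have := code_near x l.
    have := metric_triangle (d (code x l)) x (d (code x k)).
    by rewrite (metric_sym (d (code x l)) x); lra.
  - move=> k j m; exists m => l ml /(proj2 (codeP x k)) hj.
    have := metric_triangle x (d (code x l)) (d j); have := code_near x l.
    have : r l <= r m by rewrite /r lef_pV2 ?posrE ?ltr0n // ler_nat.
    by lra.
move=> [cau [near far]].
have [e e0|x hx] := @polish_cvg (fun l => d (z l)).
  have [N hN] := natSinv_small (divr_gt0 e0 (ltr0Sn _ 1)).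
  exists N => k Nk; have := cau N k; have := hN N (leqnn N); have := hN k Nk.
  by rewrite -/(r k) -/(r N); lra.
exists x => //; apply/funext => k; apply: (leastnear_uniq (codeP x k)); split.
  have [m [L hL]] := near k; have [N hN] := hx _ (r_gt0 m).
  have := hL _ (leq_maxl L N); have := hN _ (leq_maxr L N).
  by have := metric_triangle x (d (z (maxn L N))) (d (z k)); lra.
move=> j ltj; rewrite leNgt; apply/negP => lt.
have e0 : 0 < (r k - mdist x (d j)) / 2 by lra.
have [m /(_ m (leqnn m)) hm] := natSinv_small e0.
have [L hL] := far k j m; have [N hN] := hx _ e0.
have := hL _ (leq_maxl L N) ltj; have := hN _ (leq_maxr L N).
have := metric_triangle (d (z (maxn L N))) x (d j).
by rewrite -/(r m) in hm; rewrite (metric_sym (d (z (maxn L N))) x); lra.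
Qed.

Lemma polish_code : exists c : M -> baire,
  [/\ injective c, @borel_sets M = borel_of c & borel (range c)].
Proof.
by exists code; split=> //; apply/seteqP; split.
Qed.

End PolishCoding.

Lemma standard_borel_code (R : realType) X (S : set (set X)) :
  standard_borel R S -> exists c : X -> baire,
    [/\ injective c, S = borel_of c & borel (range c)].
Proof.
move=> [M [f [pM bf ->]]].
(* The empty space is treated apart because the dense sequence [d] takes [f x0] as its default. *)
have [[x0 _]|noX] := pselect (exists x : X, True); last first.
  exists (fun _ _ => 0%N); split.
  - by move=> x; case: noX; exists x.
  - have eX (A : set X) : A = set0 by apply/seteqP; split=> x; case: noX; exists x.
    apply/seteqP; split=> A _; rewrite (eX A).
      by case: (borel_of_sigma (fun (_ : X) (_ : nat) => 0%N)).
    exists set0; rewrite ?preimage_set0 ?setI0 //.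
    by case: (smallest_sigma_algebra [set: M] open).
  - rewrite (_ : range _ = set0); first by case: (borel_of_sigma (fun z : baire => z)).
    by apply/seteqP; split=> z // [x]; case: noX; exists x.
have [D [/countable_injP[h hinj] Ddense]] := proj1 pM.
pose d n := xget (f x0) [set y | D y /\ h y = n].
have d_dense x (e : R) : (0 < e)%R -> exists i, (mdist x (d i) < e)%R.
  move=> e0; have [] := Ddense (interior (ball x e)).
  - by exists x; apply: nbhsx_ballx.
  - exact: open_interior.
  move=> y [/interior_subset xy Dy]; exists (h y).
  rewrite (_ : d (h y) = y); first by rewrite ballEmdist in xy.
  rewrite /d; case: xgetP => [y' _ [Dy' hy]|/(_ y)[]//].
  by apply: hinj; rewrite ?inE.
have [c [cinj bc rc]] := polish_code pM d_dense.
have [g fg gf] := bf.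
exists (c \o f); split.
- by apply: inj_comp => //; apply: can_inj fg.
- rewrite bc; apply/seteqP; split=> A.
    move=> [B /borel_of_trace[B' bB' ->] <-]; rewrite setTI.
    exact: (borel_fun_preimage (@borel_of_coord X (c \o f)) bB').
  move=> /borel_of_trace[B bB ->]; exists [set y | B (c y)]; last by rewrite setTI.
  exact: (borel_fun_preimage (@borel_of_coord M c) bB).
- rewrite (_ : range _ = range c) //; apply/seteqP; split=> z [x _ <-].
    by exists (f x).
  by exists (g x); rewrite //= gf.
Qed.


(** * Spaces with closed image in the Baire space *)

Lemma borel_of_locally T (c : T -> baire) (U : set T) :
  (forall x, U x -> exists n, forall y, agree n (c x) (c y) -> U y) ->
  borel_of c U.
Proof.
(* There are countably many finite sequences, so a set that is locally decided by prefixes is a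
   countable union of cylinders. *)
move=> hU; rewrite (_ : U = [set y | exists s : seq nat,
    (forall z, extends s (c z) -> U z) /\ extends s (c y)]).
  apply: (sigma_exists (borel_of_sigma _)) => s.
  apply: (sigma_and (borel_of_sigma _)); first exact: (sigma_cst (borel_of_sigma _)).
  apply: (sigma_forall (borel_of_sigma _)) => i.
  apply: (sigma_imp (borel_of_sigma _)); first exact: (sigma_cst (borel_of_sigma _)).
  exact: borel_of_coord.
apply/seteqP; split=> [y Uy|y [s [sU ys]]]; last exact: sU.
have [n nU] := hU y Uy.
exists (mkseq (c y) n); split=> [z /extends_mkseq agr|]; last exact/extends_mkseq.
by apply: nU => i lt; rewrite agr.
Qed.

(* An alias of X that remembers the injection along which the metric of the Baire
   space is pulled back. *)
Definition coded (R : realType) (X : Type) (c : X -> baire) (_ : injective c) : Type := X.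

Section CodedMetric.
Variables (R : realType) (X : Type) (c : X -> baire) (c_inj : injective c).
Local Notation M := (coded R c_inj).
Local Open Scope ring_scope.

HB.instance Definition _ := gen_eqMixin M.
HB.instance Definition _ := gen_choiceMixin M.

Let differ (x y : M) : set nat := [set n | c x n <> c y n].

(** The ultrametric of the Baire space along [c]: a distance below [n.+1%:R^-1] means agreement on
    the first [n.+1] coordinates. *)
Let dist (x y : M) : R :=
  if pselect (exists n, differ x y n) is left h
  then (ex_minn (P := fun n => c x n != c y n)
    (let: ex_intro n d := h in ex_intro _ n (introN eqP d))).+1%:R^-1 else 0.

Let dist_ge0 x y : 0 <= dist x y.
Proof. by rewrite /dist; case: pselect => // h; rewrite invr_ge0. Qed.

Let dist_lt n x y : dist x y < n.+1%:R^-1 <-> agree n.+1 (c x) (c y).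
Proof.
rewrite /dist; case: pselect => [h|nd]; last first.
  rewrite invr_gt0 ltr0Sn; split=> // _ i _; apply: contrapT => d.
  by apply: nd; exists i.
case: ex_minnP => m /eqP dm min; rewrite ltf_pV2 ?posrE ?ltr0Sn // ltr_nat ltnS.
split=> [ltnm i ltin|agr].
  by apply/eqP; apply/negPn/negP => /min; rewrite leqNgt (leq_trans _ ltnm).
by rewrite ltnNge; apply/negP => lemn; apply: dm; apply: agr.
Qed.

Let dist_cases x y : dist x y = 0 \/ exists n, dist x y = n.+1%:R^-1.
Proof.
by rewrite /dist; case: pselect => h; [right|left] => //; eexists; reflexivity.
Qed.

Let distxx x : dist x x = 0.
Proof. by rewrite /dist; case: pselect => // -[n []]. Qed.

Let dist_positivity x y : dist x y = 0 -> x = y.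
Proof.
move=> d0; apply: c_inj; apply/funext => n.
by apply: (proj1 (dist_lt n x y)) => //; rewrite d0 invr_gt0 ltr0Sn.
Qed.

Let dist_sym x y : dist x y = dist y x.
Proof.
have le a b : dist a b <= dist b a.
  have [->//|[n e]] := dist_cases a b.
  rewrite leNgt e; apply/negP => /dist_lt agr.
  have /dist_lt : agree n.+1 (c a) (c b) by move=> i lt; rewrite agr.
  by rewrite e ltxx.
by apply/eqP; rewrite eq_le !le.
Qed.

Let dist_triangle y x z : dist x z <= dist x y + dist y z.
Proof.
have [->|[n e]] := dist_cases x z; first by rewrite addr_ge0.
have [lxy|xy] := ltP (dist x y) n.+1%:R^-1; last by rewrite e ler_wpDr.
have [lyz|yz] := ltP (dist y z) n.+1%:R^-1; last by rewrite e ler_wpDl.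
have /dist_lt : agree n.+1 (c x) (c z).
  by move=> i lt; rewrite (proj1 (dist_lt n x y)) // (proj1 (dist_lt n y z)).
by rewrite e ltxx.
Qed.

HB.instance Definition _ := isMetric.Build R M
  distxx dist_positivity dist_sym dist_triangle.

Let coded_ball n (x y : M) : ball x n.+1%:R^-1 y <-> agree n.+1 (c x) (c y).
Proof. by rewrite ballEmdist; exact: dist_lt. Qed.

Let coded_nbhs (x : M) (A : set M) :
  nbhs x A <-> exists n, forall y : M, agree n (c x) (c y) -> A y.
Proof.
split=> [/nbhs_ballP[e /= e0 eA]|[n nA]].
  have [n /(_ n (leqnn n)) hn] := natSinv_small e0.
  exists n.+1 => y /coded_ball xy; apply: eA; apply: le_ball xy; exact: ltW.
apply/nbhs_ballP; exists n.+1%:R^-1; first by rewrite /= invr_gt0.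
by move=> y /coded_ball agr; apply: nA => i lt; apply: agr; exact: ltnW.
Qed.

Lemma coded_borel : @borel_sets M = borel_of (c : M -> baire).
Proof.
apply/seteqP; split.
  apply: smallest_sub => // U oU.
  apply: borel_of_locally => x Ux.
  exact/coded_nbhs/(open_nbhs_nbhs (conj oU Ux)).
apply: borel_of_sub; first exact: smallest_sigma_algebra.
move=> k i; apply: sub_gen_smallest; rewrite /= openE => x /= xk.
by apply/coded_nbhs; exists k.+1 => y /= agr; rewrite -agr.
Qed.

Hypothesis c_closed :
  forall z, (forall n, exists x, agree n (c x) z) -> exists x, c x = z.

(** One point for each realised prefix gives a countable dense set. A Cauchy filter settles every
    finite prefix, and [c_closed] makes the diagonal sequence of settled entries the code of the
    limit. *)
Lemma coded_polish : polish M.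
Proof.
split=> [|F PF /cauchyP cF].
  have /choice[pick hpick] : forall s : seq nat, exists o : option M,
      forall x : M, extends s (c x) -> exists2 y, o = Some y & extends s (c y).
    move=> s; have [[x sx]|nx] := pselect (exists x : M, extends s (c x)).
      by exists (Some x) => _ _; exists x.
    by exists None => x sx; case: nx; exists x.
  exists [set x | exists s, pick s = Some x]; split.
    have : countable (Some @` [set x : M | exists s, pick s = Some x]).
      apply: (@sub_countable _ _ _ (range pick)).
        by apply: subset_card_le => _ [x [s sx] <-]; exists s.
      exact: card_le_trans (card_image_le _ _) (countableP _).
    move/countable_injP => [h hinj]; apply/countable_injP; exists (h \o Some).
    move=> x y; rewrite !inE => hx hy /= e.
    suff: Some x = Some y by case.
    by apply: hinj e; rewrite inE; [exists x|exists y].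
  move=> U [x Ux] oU; have /coded_nbhs[n nU] := open_nbhs_nbhs (conj oU Ux).
  have [|y sy /extends_mkseq agr] := hpick (mkseq (c x) n) x.
    exact/extends_mkseq.
  exists y; split; last by exists (mkseq (c x) n).
  by apply: nU => i lt; rewrite agr.
have /choice[x hx] : forall n, exists x : M, F [set y : M | agree n.+1 (c x) (c y)].
  move=> n; have [|x Fx] := cF n.+1%:R^-1; first by rewrite invr_gt0.
  by exists x; apply: filterS Fx => y /coded_ball.
have [n|y hy] := c_closed (z := fun n => c (x n) n).
  exists (x n) => i lin.
  have [w [/= wn wi]] := filter_ex (filterI (hx n) (hx i)).
  by rewrite (wn i (leqW lin)) (wi i (ltnSn i)).
exists y => A /coded_nbhs[n nA]; apply: filterS (hx n) => w agr; apply: nA => i lin.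
rewrite hy; have [v [/= vn vi]] := filter_ex (filterI (hx n) (hx i)).
by rewrite (vi i (ltnSn i)) -(vn i (leqW lin)) (agr i (leqW lin)).
Qed.

End CodedMetric.

Lemma standard_borel_closed_image (R : realType) X (c : X -> baire) :
  injective c ->
  (forall z, (forall n, exists x, agree n (c x) z) -> exists x, c x = z) ->
  standard_borel R (borel_of c).
Proof.
move=> c_inj c_closed; exists (coded R c_inj), id; split.
- exact: coded_polish.
- by exists id.
- rewrite coded_borel /preimage_set_system.
  by under eq_fun do rewrite setTI; rewrite image_id.
Qed.

(* The Feldman-Moore theorem for quasi-orders. Off the image of X the relation P is
   equality, so that the f n can be total. *)
Lemma quasi_order_borel_funs (R : realType) X (S : set (set X)) Q :
  countable_borel_quasi_order R S Q ->
  exists (c : X -> baire) (P : baire -> baire -> Prop)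
         (f : nat -> baire -> baire),
    [/\ S = borel_of c, forall n, borel_fun (fun z => z) (f n),
        forall u v w, P u v -> P v w -> P u w,
        forall u v, P u v <-> exists n, u = f n v &
        forall x y, Q x y <-> P (c x) (c y)].
Proof.
move=> [sX Qxx Qtr bQ cQ]; have [c [cinj SE rc]] := standard_borel_code sX.
pose cc (p : X * X) := interleave (c p.1) (c p.2).
have [B bB QB] : exists2 B, borel B & forall x y, Q x y <-> B (interleave (c x) (c y)).
  have [|B bB e] := @borel_of_trace _ cc [set p | Q p.1 p.2]; last first.
    exists B => // x y; have /= := congr1 (fun A => A (x, y)) e.
    by rewrite -[X in _ = X]/(B (interleave (c x) (c y))) => <-.
  move: bQ; apply: smallest_sub => //; rewrite SE.
  move=> _ [] [_ /borel_of_trace[A bA ->] <-]; rewrite setTI.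
    apply: (borel_fun_preimage (f := fun p : X * X => c p.1) _ bA) => k i.
    rewrite (_ : [set x | _] = [set p | cc p k.*2 = i]); first exact: borel_of_coord.
    by apply/seteqP; split=> p; rewrite /= /cc interleave_double.
  apply: (borel_fun_preimage (f := fun p : X * X => c p.2) _ bA) => k i.
  rewrite (_ : [set x | _] = [set p | cc p k.*2.+1 = i]); first exact: borel_of_coord.
  by apply/seteqP; split=> p; rewrite /= /cc interleave_doubleS.
pose P u v := u = v \/ range c u /\ (range c v /\ B (interleave u v)).
have PQ x y : Q x y <-> P (c x) (c y).
  split=> [/QB Qxy|[/cinj -> //|[_ [_ /QB //]]]].
  by right; split; [exists x|split; [exists y|]].
have Pxx u : P u u by left.
have Ptr u v w : P u v -> P v w -> P u w.
  move=> [-> //|[[x _ <-] [[y _ <-] Bxy]]] [<-|[_ [[z _ <-] Byz]]].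
    by right; split; [exists x|split; [exists y|]].
  apply/PQ; apply: (Qtr _ y); exact/QB.
(* The larger point comes first, because the Lusin-Novikov functions compute the second coordinate
   from the first. *)
have bP : borel [set z | P (odds z) (evens z)].
  apply: (sigma_or (borel_of_sigma _)).
    exact: borel_fun_eq borel_fun_odds borel_fun_evens.
  apply: (sigma_and (borel_of_sigma _)); first exact: borel_fun_preimage borel_fun_odds rc.
  apply: (sigma_and (borel_of_sigma _)); first exact: borel_fun_preimage borel_fun_evens rc.
  apply: (borel_fun_preimage _ bB).
  exact: borel_fun_interleave borel_fun_odds borel_fun_evens.
have cP v : countable [set u | P u v].
  have [[y _ <-]|nv] := pselect (range c v).
    apply: (@sub_countable _ _ _ [set x | Q x y]) => //.
    apply: card_le_trans (card_image_le c _); apply: subset_card_le => u /=.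
    move=> [->|[[x _ <-] [_ /QB Qxy]]]; first by exists y.
    by exists x.
  apply: (@sub_countable _ _ _ [set v]); last exact: countable1.
  by apply: subset_card_le => u [->|[_ [/nv]]].
have [v|g bg hg] := lusin_novikov (borel_analytic bP).
  apply: sub_countable (cP v); apply: subset_card_le => u /=.
  by rewrite odds_interleave evens_interleave.
(* Where [g n v] is not below [v], the default [v] is, by reflexivity; so every value [f n v] lies
   below [v]. *)
pose f n v := if pselect (P (g n v) v) then g n v else v.
exists c, P, f; split=> //.
- move=> n k i; rewrite (_ : [set x | _] = [set v | (P (g n v) v /\ g n v k = i) \/
     (~ P (g n v) v /\ v k = i)]).
    have bPg : borel [set v | P (g n v) v].
      rewrite (_ : [set v | _] = [set v | [set z | P (odds z) (evens z)]
          (interleave v (g n v))]).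
        apply: borel_fun_preimage bP; apply: borel_fun_interleave => // k' i'.
        exact: borel_of_coord.
      by apply/seteqP; split=> v; rewrite /= odds_interleave evens_interleave.
    apply: (sigma_or (borel_of_sigma _)); apply: (sigma_and (borel_of_sigma _)) => //.
    - exact: bg.
    - exact: (sigma_not (borel_of_sigma _)).
    - exact: borel_of_coord.
  by apply/seteqP; split=> v /=; rewrite /f; case: pselect => p;
    [left|right|case=> -[]|case=> -[]].
- move=> u v; split=> [Puv|[n ->]]; last by rewrite /f; case: pselect.
  have [n un] : exists n, u = g n v.
    by apply: hg; rewrite /= odds_interleave evens_interleave.
  by exists n; rewrite /f -un; case: pselect.
Qed.

(** * Coding points by subsets of a group with a free subgroup *)

Local Open Scope group_scope.


(** * Positive words in two free generators *)

Definition heads_differ (v w : seq bool) : bool :=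
  if (v, w) is (x :: _, y :: _) then x != y else true.

Section FreeWords.
Variables (G : groupType) (gen : bool -> G).

Definition word_val (w : seq bool) : G := \prod_(x <- w) gen x.

Definition signed (c : bool) (w : seq bool) := [seq (gen x, c) | x <- w].

Lemma word_val_cat v w : word_val (v ++ w) = word_val v * word_val w.
Proof. exact: big_cat. Qed.

Lemma word_value_signed v w :
  word_value (signed true (rev v) ++ signed false w) = (word_val v)^-1 * word_val w.
Proof.
rewrite /word_value big_cat /= !big_map /=; congr (_ * _).
by rewrite prodgV revK.
Qed.

Hypothesis gen_inj : injective gen.

(** Letters of equal sign never cancel, so the only place to check is the junction, where the heads
    of [v] and [w] meet. *)
Lemma freely_reduced_signed v w :
  heads_differ v w ->
  freely_reduced (signed true (rev v) ++ signed false w).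
Proof.
have same c u : freely_reduced (signed c u).
  rewrite /freely_reduced /signed sorted_map.
  by case: u => //= x u; elim: u x => //= y u IH x; rewrite eqxx andbF IH.
case: w => [_|y w]; first by rewrite cats0; apply: same.
case: v => [_|x v xy]; first by rewrite /rev /=; apply: (same false (y :: w)).
rewrite /freely_reduced /signed rev_cons map_rcons cat_rcons sorted_cat_cons.
have := same true (rev (x :: v)).
rewrite /freely_reduced /signed rev_cons map_rcons => ->.
rewrite /heads_differ in xy; rewrite /= andbT (inj_eq gen_inj) xy /=.
exact: (same false (y :: w)).
Qed.

Lemma strip_common_prefix (v w : seq bool) : exists z v' w',
  [/\ v = z ++ v', w = z ++ w' & heads_differ v' w'].
Proof.
elim: v w => [|x v IH] [|y w].
- by exists [::], [::], [::].
- by exists [::], [::], (y :: w).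
- by exists [::], (x :: v), [::].
have [<-|xy] := eqVneq x y; last by exists [::], (x :: v), (y :: w).
by have [z [v' [w' [-> -> h]]]] := IH w; exists (x :: z), v', w'.
Qed.

Hypothesis reduced_inj : {in [pred w | freely_reduced w && all (mem (codom gen)) (unzip1 w)] &,
  injective (@word_value G)}.

(** Once common prefixes are stripped, both quotients are freely reduced and hence equal as words;
    sorting the letters by sign recovers the two remaining parts. *)
Lemma word_val_quotient_inj s p t q :
  (word_val s)^-1 * word_val p = (word_val t)^-1 * word_val q ->
  exists z z' s' p', [/\ s = z ++ s', p = z ++ p', t = z' ++ s' & q = z' ++ p'].
Proof.
have [z [s' [p' [-> -> sp]]]] := strip_common_prefix s p.
have [z' [t' [q' [-> -> tq]]]] := strip_common_prefix t q.
have cancel_prefix u v w : (word_val (u ++ v))^-1 * word_val (u ++ w) =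
    word_value (signed true (rev v) ++ signed false w).
  by rewrite word_value_signed !word_val_cat invgM -mulgA mulKg.
rewrite !cancel_prefix => /reduced_inj e.
have dom v w : all (mem (codom gen)) (unzip1 (signed true (rev v) ++ signed false w)).
  apply/allP => g /mapP[[h c]]; rewrite mem_cat.
  by case/orP => /mapP[x _ [-> _]] ->; apply: codom_f.
have {}e := e _ _; have {e} : signed true (rev s') ++ signed false p' =
    signed true (rev t') ++ signed false q'.
  by apply: e; rewrite inE dom andbT; apply: freely_reduced_signed.
move=> e; have signE c d u : [seq i.1 | i <- signed c u & i.2 == d] =
    if c == d then map gen u else [::].
  by elim: u => [|x u] /=; case: eqP => //= _ ->.
have filt d := congr1 (fun u => [seq i.1 | i <- u & i.2 == d]) e.
have := filt true; have := filt false.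
rewrite !filter_cat !map_cat !signE /= !cats0 => /(inj_map gen_inj) <-.
move=> /(inj_map gen_inj)/(congr1 rev); rewrite !revK => <-.
by exists z, z', s', p'.
Qed.

Lemma word_val_inj : injective word_val.
Proof.
move=> p q e; have [|z [z' [s' [p' [es -> et ->]]]]] :=
    @word_val_quotient_inj [::] p [::] q.
  by rewrite e.
by case: z es => // _; case: z' et.
Qed.

End FreeWords.

(** With at most one free generator all generators would commute, and so would all values of words,
    making [F] abelian. *)
Lemma free_pair (G : groupType) : has_nonabelian_free_subgroup G ->
  exists2 gen : bool -> G, injective gen &
    {in [pred w | freely_reduced w && all (mem (codom gen)) (unzip1 w)] &,
      injective (@word_value G)}.
Proof.
move=> [F [[_ [S bij]] ncom]].
have [_ inj surj] := bij.
have [[a [b [Sa Sb ab]]]|nab] := pselect (exists a b, [/\ S a, S b & a <> b]).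
  pose gen (x : bool) := if x then b else a.
  exists gen; first by move=> [] [] //= e; case: ab.
  move=> v w; rewrite !inE => /andP[rv /allP dv] /andP[rw /allP dw]; apply: inj.
    rewrite inE; split=> // x xv; have : x.1 \in unzip1 v by apply: map_f.
    by move/dv => /codomP[[] ->].
  rewrite inE; split=> // x xw; have : x.1 \in unzip1 w by apply: map_f.
  by move/dw => /codomP[[] ->].
case: ncom => x y; rewrite !inE => /surj[v [_ Sv] <-] /surj[w [_ Sw] <-].
have cS (g h : G) : S g -> S h -> commute g h.
  by move=> Sg Sh; have [->//|gh] := pselect (g = h); case: nab; exists g, h.
have commuteVl (g h : G) : commute g h -> commute g^-1 h.
  by move=> /commute_sym/commuteV/commute_sym.
rewrite /word_value big_seq [in X in commute _ X]big_seq.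
apply: commute_prod => j /Sw Sj; apply: commute_sym; apply: commute_prod => i /Sv Si.
have := cS _ _ Sj Si.
by case: i.2; case: j.2 => c; do ?[apply: commuteV|apply: commuteVl].
Qed.


(* A letter Some n applies the n-th function and None leads to a sink. A leaf inl b
   marks a node, and a leaf inr i records one value of the point at the node. *)
Definition letter := option nat.
Definition leaf := (bool + nat)%type.

(** Together with [leaf_code] a prefix code: [11] opens a function, [010] is the sink, [00] and [10]
    are the marks, [011] opens a value. The endings matter too: the codes of [Some n] and [None]
    have different last bits. *)
Definition letter_code (l : letter) : seq bool :=
  if l is Some n then [:: true, true & nseq n false ++ [:: true]]
  else [:: false; true; false].

Definition leaf_code (d : leaf) : seq bool :=
  match d with
  | inl x => [:: x; false]
  | inr i => [:: false, true, true & nseq i true ++ [:: false; true]]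
  end.

Definition path_code (x : seq letter) := flatten (map letter_code x).

Lemma nseq_prefix_code (x y : bool) m n v w : x != y ->
  nseq m x ++ y :: v = nseq n x ++ y :: w -> m = n /\ v = w.
Proof.
move=> xy; elim: m n => [|m IH] [|n] /=.
- by case.
- by case=> e; rewrite e eqxx in xy.
- by case=> e; rewrite e eqxx in xy.
- by case=> /IH[-> ->].
Qed.

Lemma letter_prefix_code l l' v w :
  letter_code l ++ v = letter_code l' ++ w -> l = l' /\ v = w.
Proof.
case: l l' => [n|] [n'|] //=; last by case.
by rewrite -!catA /= => -[/nseq_prefix_code[]// -> ->].
Qed.

Lemma leaf_prefix_code d l v w : leaf_code d ++ v <> letter_code l ++ w.
Proof. by case: d l => [[]|i] [n|]. Qed.

Lemma leaf_code_inj : injective leaf_code.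
Proof.
case=> [x|i] [y|j] //=; first by case=> ->.
by case=> /nseq_prefix_code[]// ->.
Qed.

Lemma path_code_inj x d x' d' :
  path_code x ++ leaf_code d = path_code x' ++ leaf_code d' -> x = x' /\ d = d'.
Proof.
rewrite /path_code; elim: x x' => [|l x IH] [|l' x'] /=.
- by move/leaf_code_inj.
- by rewrite -catA -[leaf_code d]cats0 => /leaf_prefix_code.
- by rewrite -catA -[leaf_code d']cats0 => /esym/leaf_prefix_code.
- by rewrite -!catA => /letter_prefix_code[-> /IH[-> ->]].
Qed.

(** Among the leaf codes only the mark [00] ends in [00]. *)
Lemma path_code_suffix w x d :
  w ++ [:: false; false] = path_code x ++ leaf_code d -> w = path_code x.
Proof.
rewrite -[[:: false; false]]/([:: false] ++ [:: false]) catA !cats1.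
case: d => [y|i] /=.
  rewrite -[[:: y; false]]/([:: y] ++ [:: false]) catA !cats1.
  by move=> /rcons_inj[] /rcons_inj[->].
rewrite -[_ :: _]/([:: false, true, true & nseq i true] ++ [:: false; true]).
rewrite -[[:: false; true]]/([:: false] ++ [:: true]) !catA !cats1.
by move=> /rcons_inj[].
Qed.

Lemma infinite_set_injection T (A : set T) (e : nat -> T) :
  injective e -> (forall k, A (e k)) -> infinite_set A.
Proof.
move=> e_inj Ae /(finite_preimage (f := e)) h; apply: infinite_nat.
rewrite (_ : [set: nat] = e @^-1` A); last by apply/seteqP; split=> k _ /=.
by apply: h => ? ? _ _; apply: e_inj.
Qed.

Section Coding.
Variable f : nat -> baire -> baire.

Definition step (o : option baire) (l : letter) : option baire :=
  if (o, l) is (Some v, Some n) then Some (f n v) else None.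

(** The value leaves at a point are its graph, so an inclusion between the leaves of two points
    forces equality, and no point allows all leaves as the sink does. *)
Definition has_leaf (o : option baire) (d : leaf) : Prop :=
  match o, d with
  | Some v, inr i => exists k, i = pickle (k, v k)
  | _, _ => True
  end.

Definition tree (o : option baire) : set (seq bool) :=
  [set w | exists x d, w = path_code x ++ leaf_code d /\ has_leaf (foldl step o x) d].

Lemma tree_path o x d :
  tree o (path_code x ++ leaf_code d) <-> has_leaf (foldl step o x) d.
Proof.
split=> [[x' [d' [/path_code_inj[<- <-]]]]//|h].
by exists x, d.
Qed.

Lemma tree_letter o l w : tree o (letter_code l ++ w) <-> tree (step o l) w.
Proof.
split=> [[[|l' x] [d [/= e h]]]|[x [d [-> h]]]].
- by case: (@leaf_prefix_code d l [::] w); rewrite cats0.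
- rewrite /path_code /= -catA in e; have [el ew] := letter_prefix_code e.
  by exists x, d; rewrite el -ew.
- by exists (l :: x), d; rewrite /path_code /= catA.
Qed.

Lemma foldl_step_None x : foldl step None x = None.
Proof. by elim: x. Qed.

Lemma tree_sink o w : tree o w -> tree None w.
Proof. by move=> [x [d [-> _]]]; exists x, d; rewrite foldl_step_None. Qed.

Lemma foldl_step_Some v x v' : foldl step (Some v) x = Some v' ->
  exists s : seq nat, v' = foldl (fun u n => f n u) v s.
Proof.
elim: x v => [|[n|] x IH] v /=; first by case=> <-; exists [::].
  by move/IH => [s ->]; exists (n :: s).
by rewrite foldl_step_None.
Qed.

Lemma has_leaf_data_inj u v :
  (forall k, has_leaf (Some v) (inr (pickle (k, u k)))) -> u = v.
Proof.
move=> h; apply/funext => k; have [k' /= /(pcan_inj pickleK)[]] := h k.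
by move=> <-.
Qed.

Variables (G : groupType) (gen : bool -> G).
Hypothesis gen_quotient_inj : forall s p t q,
  (word_val gen s)^-1 * word_val gen p = (word_val gen t)^-1 * word_val gen q ->
  exists z z' s' p', [/\ s = z ++ s', p = z ++ p', t = z' ++ s' & q = z' ++ p'].
Hypothesis gen_inj : injective (word_val gen).

Local Notation val := (word_val gen).

Definition tree_set (v : baire) : set G := val @` tree (Some v).

Lemma tree_set_val v w : tree_set v (val w) <-> tree (Some v) w.
Proof. by split=> [[w' h /gen_inj <-]|h]; last exists w. Qed.

(** If both products lie in the tree, [g] is a quotient of positive words in two ways, so the codes
    of [Some n] and [None] share the suffix [s]. Their last bits differ, hence [s] is empty and [g]
    is itself a positive word. *)
Lemma tree_set_step v n g : tree_set (f n v) g <->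
  tree_set v (val (letter_code (Some n)) * g) /\
  tree_set v (val (letter_code None) * g).
Proof.
split=> [[w tw <-]|[[w tw ew] [w' tw' ew']]].
  rewrite -!word_val_cat !tree_set_val !tree_letter; split=> //.
  exact: tree_sink tw.
have [|z [z' [s [p [es ep et eq]]]]] := @gen_quotient_inj
    (letter_code (Some n)) w (letter_code None) w'.
  by rewrite ew ew' !mulKg.
have s0 : s = [::].
  case/lastP: s es et => // s x; rewrite -!rcons_cat.
  rewrite (_ : letter_code None = rcons [:: false; true] false) //.
  rewrite (_ : letter_code (Some n) = rcons [:: true, true & nseq n false] true).
    by move=> /rcons_inj[_ <-] /rcons_inj[].
  by rewrite /= cats1.
have gp : g = val p.
  by apply: (mulgI (val (letter_code (Some n)))); rewrite -ew ep es s0 cats0 word_val_cat.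
rewrite gp tree_set_val; apply/(tree_letter (Some v) (Some n)).
by rewrite es s0 cats0 -ep.
Qed.

(* The marks 00 and 10 force every translate to be based at a node. *)
Lemma tree_set_translate v h :
  tree_set v (h * val (leaf_code (inl false))) ->
  tree_set v (h * val (leaf_code (inl true))) ->
  exists x, h = val (path_code x).
Proof.
move=> [w0 [x [d [ew0 _]]] e0] [w1 _ e1].
have [|z [z' [s [p [es ep et eq]]]]] := @gen_quotient_inj w1 w0
    (leaf_code (inl true)) (leaf_code (inl false)).
  by rewrite e0 e1 invgM -mulgA mulKg.
(* [z'] is a common prefix of the marks [10] and [00], which differ in the first bit. *)
have z'0 : z' = [::].
  by case: z' et eq => //= y z' [<- _].
move: et eq; rewrite z'0 /= => es' ep'.
have zx : z = path_code x by apply: (@path_code_suffix _ _ d); rewrite -ew0 ep -ep'.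
exists x; apply: (mulIg (val (leaf_code (inl false)))).
by rewrite -e0 ep -ep' word_val_cat zx.
Qed.

Lemma tree_set_inter u v (hs : seq G) :
  (forall g, tree_set u g <-> forall h, h \in hs -> tree_set v (h * g)) ->
  exists s : seq nat, u = foldl (fun x n => f n x) v s.
Proof.
move=> hu.
have leafE o d : tree o (leaf_code d) <-> has_leaf o d := tree_path o [::] d.
have node h : h \in hs -> exists x, h = val (path_code x).
  move=> hhs; apply: (@tree_set_translate v);
    by apply: (proj1 (hu _)) => //; rewrite tree_set_val leafE.
have datum d h x : h \in hs -> h = val (path_code x) ->
    has_leaf (Some u) d -> has_leaf (foldl step (Some v) x) d.
  move=> hhs hx; rewrite -leafE -tree_set_val hu => /(_ h hhs).
  by rewrite hx -word_val_cat tree_set_val tree_path.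
have [[h [x [v' [hhs hx xv]]]]|nex] := pselect (exists h x v',
    [/\ h \in hs, h = val (path_code x) & foldl step (Some v) x = Some v']).
  rewrite (_ : u = v'); first exact: foldl_step_Some xv.
  apply: has_leaf_data_inj => k; rewrite -xv; apply: (datum _ _ _ hhs hx).
  by exists k.
(* If every translate is based at the sink, or [hs] is empty, then [u] allows all leaves, even one
   that records a wrong value at 0. *)
have full d : has_leaf (Some u) d.
  rewrite -leafE -tree_set_val hu => h hhs; have [x hx] := node h hhs.
  rewrite hx -word_val_cat tree_set_val tree_path.
  by case e : (foldl _ _ _) => [v'|//]; case: nex; exists h, x, v'.
have [k /(pcan_inj pickleK)[<-]] := full (inr (pickle (0%N, (u 0%N).+1))).
by move=> e; lia.
Qed.

Lemma tree_set_infinite v : infinite_set (tree_set v).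
Proof.
pose e k := val (leaf_code (inr (pickle (k, v k)))).
have e_inj : injective e.
  by move=> k k' /gen_inj/leaf_code_inj[/(pcan_inj pickleK)[]].
apply: (infinite_set_injection e_inj) => k.
apply/tree_set_val; rewrite -[leaf_code _]/(path_code [::] ++ leaf_code _).
by apply/tree_path; exists k.
Qed.

Lemma borel_tree_set (T : Type) c (p : T -> baire) g :
  (forall n, borel_fun (fun z => z) (f n)) -> borel_fun c p ->
  borel_of c [set t | tree_set (p t) g].
Proof.
move=> bf bp.
have bleaf x d (q : T -> baire) : borel_fun c q ->
    borel_of c [set t | has_leaf (foldl step (Some (q t)) x) d].
  elim: x q => [|[n|] x IH] q bq /=.
  - case: d => [y|i]; first exact: (sigma_cst (borel_of_sigma _)).
    apply: (sigma_exists (borel_of_sigma _)) => k.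
    rewrite (_ : [set t | _] = [set t | exists j, q t k = j /\ i = pickle (k, j)]).
      apply: (sigma_exists (borel_of_sigma _)) => j.
      apply: (sigma_and (borel_of_sigma _)); first exact: bq.
      exact: (sigma_cst (borel_of_sigma _)).
    by apply/seteqP; split=> t /=; [exists (q t k)|case=> j [-> ->]].
  - by apply: (IH (fun t => f n (q t))); apply: (borel_fun_comp bq).
  - by under eq_set do rewrite /step foldl_step_None; exact: (sigma_cst (borel_of_sigma _)).
rewrite (_ : [set t | _] = [set t | exists x, exists d,
    val (path_code x ++ leaf_code d) = g /\ has_leaf (foldl step (Some (p t)) x) d]).
  apply: (sigma_exists (borel_of_sigma _)) => x.
  apply: (sigma_exists (borel_of_sigma _)) => d.
  apply: (sigma_and (borel_of_sigma _)); first exact: (sigma_cst (borel_of_sigma _)).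
  exact: bleaf.
apply/seteqP; split=> t /=.
  by move=> [_ [x [d [-> h]]] <-]; exists x, d.
by move=> [x [d [<- h]]]; exists (path_code x ++ leaf_code d) => //; exists x, d.
Qed.

End Coding.

(** * Subgroups of the free product *)


Section Walks.
Variables G H : groupType.
Implicit Types (A B : set G) (p q r g : G) (x y k : free_product G H).
Implicit Types u v w : seq (G + H).

(* Reading a word moves a point of G by right multiplication with the letters of
   G; the letters of H may only be read at points of A. *)
Fixpoint walk A p q w : Prop :=
  match w with
  | [::] => p = q
  | inl g :: w' => walk A (p * g) q w'
  | inr _ :: w' => A p /\ walk A p q w'
  end.

Lemma walk_cat A p q u v :
  walk A p q (u ++ v) <-> exists2 r, walk A p r u & walk A r q v.
Proof.
elim: u p => [|[g|h] u IH] p /=.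
- by split=> [wv|[r ->]]; first exists p.
- exact: IH.
- by rewrite IH; split=> [[Ap [r wu wv]]|[r [Ap wu] wv]]; [exists r|split=> //; exists r].
Qed.

(** Merging letters of [G] composes moves, while merging or deleting letters of [H] only forgets
    conditions; hence one direction only. *)
Lemma walk_mul_letter A p q (t : G + H) w :
  walk A p q (t :: w) -> walk A p q (mul_letter t w).
Proof.
case: w => [|y w].
  rewrite /mul_letter /push_letter; case: ifP => // nx wx; move: nx wx.
  by case: t => [g|h] /=; [move/negbFE/eqP ->; rewrite mulg1|move=> _ []].
rewrite /mul_letter; case: t y => [g|h] [g'|h'] //=; rewrite /push_letter /=.
- case: eqP => /= [e|_]; last by rewrite mulgA.
  by rewrite -mulgA e mulg1.
- by case: eqP => //= ->; rewrite mulg1.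
- by case: eqP => //= _ [].
- by case: eqP => //= _ [? []].
Qed.

Lemma walk_mul_word A p q u v : walk A p q (u ++ v) -> walk A p q (mul_word u v).
Proof.
elim: u p => //= x u IH p w; apply: walk_mul_letter.
by case: x w => [g|h] /=; [apply: IH|case=> Ap /IH].
Qed.

Lemma walk_inv_word A p q w : walk A p q w -> walk A q p (inv_word w).
Proof.
elim: w p => [|x w IH] p; first by move=> ->.
rewrite /inv_word map_cons rev_cons -cats1 => wx; apply/walk_cat.
case: x wx => [g|h] /=.
  by move/IH => w'; exists (p * g); rewrite ?mulgK.
by case=> Ap /IH w'; exists p.
Qed.

Lemma walk_mul A p q r x y : walk A p q x -> walk A q r y -> walk A p r (x * y).
Proof. by move=> wx wy; apply: walk_mul_word; apply/walk_cat; exists q. Qed.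

Lemma walk_inv A p q x : walk A p q x -> walk A q p x^-1.
Proof. exact: walk_inv_word. Qed.

Lemma walk_conj A p q x y : walk A p q x -> walk A p p (x * y * x^-1) <-> walk A q q y.
Proof.
move=> wx; split=> w; last first.
  by apply: (walk_mul _ (walk_inv wx)); apply: walk_mul w.
rewrite (_ : y = x^-1 * (x * y * x^-1) * x); last by rewrite !mulgA mulVg mul1g mulgVK.
by apply: (walk_mul _ wx); apply: walk_mul w; apply: walk_inv.
Qed.

Lemma walk_translate A g p q w :
  walk A (g * p) (g * q) w <-> walk [set r | A (g * r)] p q w.
Proof.
elim: w p => [|[g'|h] w IH] p /=.
- by split=> [/mulgI|->].
- by rewrite -mulgA.
- by rewrite IH.
Qed.

Definition normal_form w : free_product G H :=
  FreeProduct (mul_word_reduced w (isT : reduced_word [::])).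

Lemma normal_form_cat u v : normal_form (u ++ v) = normal_form u * normal_form v.
Proof.
apply: val_inj => /=; rewrite -mul_wordA ?mul_word_reduced //.
by rewrite /mul_word foldr_cat.
Qed.

Lemma normal_form_reduced w : reduced_word w -> normal_form w = w :> seq _.
Proof. exact: mul_word1. Qed.

Lemma normal_formK x : normal_form x = x.
Proof. by apply: val_inj; apply: normal_form_reduced; apply: fp_reduced. Qed.

Lemma normal_form_letter (s t t' : G + H) : letter_mul s t = Some t' ->
  normal_form [:: s] * normal_form [:: t] = normal_form [:: t'].
Proof. by move=> st; rewrite -normal_form_cat; apply: val_inj; apply: mul_letterA. Qed.

Definition inG g := normal_form [:: inl g].
Definition inH (h : H) := normal_form [:: inr h].

Lemma inG1 : inG 1 = 1.
Proof. by apply: val_inj; apply: mul_letter1; rewrite //= eqxx. Qed.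

Lemma inH1 : inH 1 = 1.
Proof. by apply: val_inj; apply: mul_letter1; rewrite //= eqxx. Qed.

Lemma inGM g g' : inG (g * g') = inG g * inG g'.
Proof. by rewrite (@normal_form_letter _ _ (inl (g * g'))). Qed.

Lemma inHM h h' : inH (h * h') = inH h * inH h'.
Proof. by rewrite (@normal_form_letter _ _ (inr (h * h'))). Qed.

Lemma inHV h : inH h^-1 = (inH h)^-1.
Proof. by apply/esym/mulg1_eq; rewrite -inHM mulgV inH1. Qed.

Lemma walk_normal_form A p q w : walk A p q w -> walk A p q (normal_form w).
Proof. by move=> h; apply: walk_mul_word; rewrite cats0. Qed.

Lemma walk_inG A p g : walk A p (p * g) (inG g).
Proof. exact: walk_normal_form. Qed.

Lemma walk_inH A p h : A p -> walk A p p (inH h).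
Proof. by move=> Ap; apply: walk_normal_form. Qed.

(* After absorbing a last H-letter of x into h, the product x h x^-1 is a reduced
   word running through the reading of x. *)
Lemma walk_conj_inH A h x : h != 1 -> walk A 1 1 (x * inH h * x^-1) ->
  exists2 b, A b & walk A 1 b x.
Proof.
move=> h1.
have [y [h' [h'1 ylast xE xh]]] : exists (y : free_product G H) (h' : H), [/\ h' != 1,
    (if rev y is inr _ :: _ then false else true),
    (forall b, A b -> walk A 1 b y -> walk A 1 b x) &
    x * inH h * x^-1 = y * inH h' * y^-1].
  case/lastP e : (fp_word x) => [|w [g|t]].
  - by exists x, h; split=> //; rewrite e.
  - by exists x, h; split=> //; rewrite e // rev_rcons.
  have rw : reduced_word w /\ (if rev w is inr _ :: _ then false else true).
    have := fp_reduced x; rewrite e /reduced_word all_rcons => /andP[/andP[_ nw] sw].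
    rewrite nw /=; case/lastP: w {e nw} sw => [|w s] //.
    rewrite -!cats1 -catA /= => sw; split.
      have := @cat_sorted2 _ (@Defs.alternating G H) (w ++ [:: s]) [:: inr t].
      by rewrite -catA => /(_ sw)[].
    move: sw; rewrite sorted_cat_cons /= andbT => /andP[_].
    by rewrite cats1 rev_rcons; case: s.
  have xw : x = normal_form w * inH t.
    by rewrite -normal_form_cat cats1 -e normal_formK.
  exists (normal_form w), (t * h * t^-1); split.
  - by rewrite -(inj_eq (mulIg t)) mulgVK mul1g -{2}(mulg1 t) (inj_eq (mulgI t)).
  - by rewrite normal_form_reduced //; case: rw.
  - move=> b Ab; rewrite normal_form_reduced; last by case: rw.
    by rewrite -cats1 => wb; apply/walk_cat; exists b.
  - by rewrite xw !inHM inHV invgM !mulgA.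
have red : reduced_word (fp_word y ++ inr h' :: inv_word y).
  have := inv_word_reduced (fp_reduced y); have := fp_reduced y.
  rewrite /reduced_word => /andP[ny sy] /andP[niy siy].
  rewrite all_cat /= ny h'1 niy /= sorted_cat_cons.
  move: ylast sy siy; case/lastP: (fp_word y) => [|w t] //=.
  rewrite rev_rcons /inv_word map_rcons rev_rcons -!cats1 -catA.
  case: t => [g|] // _ sw; rewrite /= => ->; rewrite andbT sorted_cat_cons /= andbT.
  by rewrite -cats1.
have e : x * inH h * x^-1 = normal_form (fp_word y ++ inr h' :: inv_word y).
  rewrite xh -cat1s !normal_form_cat normal_formK mulgA.
  by rewrite -[in LHS](normal_formK y^-1).
rewrite e normal_form_reduced // => /walk_cat[b wy /= [Ab _]].
by exists b => //; apply: xE.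
Qed.

(* A conjugate a h a^-1 in the conjugated subgroup forces x^-1 a to be a walk in B, and
   conjugation by a walk only moves the base point. *)
Lemma conj_walk_translate A B x : (exists h : H, h != 1) -> A !=set0 ->
  (forall y, walk A 1 1 y -> walk B 1 1 (x^-1 * y * x)) ->
  exists g, forall y, walk B 1 1 (x^-1 * y * x) <-> walk [set r | B (g * r)] 1 1 y.
Proof.
move=> [h h1] [a Aa] AB; pose m := x^-1 * inG a.
have xE : x^-1 = m * inG a^-1 by rewrite /m -mulgA -inGM mulgV inG1 mulg1.
have [|b Bb wm] := @walk_conj_inH B h m h1.
  have -> : m * inH h * m^-1 = x^-1 * (inG a * inH h * (inG a)^-1) * x.
    by rewrite /m invgM invgK !mulgA.
  apply: AB; apply/(@walk_conj A 1 a); last exact: walk_inH.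
  by have := walk_inG A 1 a; rewrite mul1g.
(* [m] walks from 1 to [b], and [x^-1] is [m] followed by [inG a^-1], which moves the base point on
   to [b * a^-1]. *)
exists (b * a^-1) => y.
have -> : x^-1 * y * x = m * (inG a^-1 * y * (inG a^-1)^-1) * m^-1.
  by rewrite !mulgA -xE -!mulgA -invgM -xE invgK.
rewrite (walk_conj _ wm) (walk_conj _ (walk_inG _ _ _)).
by rewrite -walk_translate mulg1.
Qed.

Lemma walk_functional A p q q' w : walk A p q w -> walk A p q' w -> q = q'.
Proof.
elim: w p => [|[g|h] w IH] p /=; first by move=> <-.
  exact: IH.
by move=> [_ +] [_ +]; apply: IH.
Qed.

(** The course of a walk depends on the word alone; the set only restricts where letters of [H] are
    read. So intersecting sets intersects the subgroups. *)
Lemma walk_and A B C p q w : (forall r, A r <-> B r /\ C r) ->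
  walk A p q w <-> walk B p q w /\ walk C p q w.
Proof.
move=> ABC; elim: w p => [|[g|h] w IH] p /=; [by split=> [|[]]|exact: IH|].
by rewrite ABC IH; split=> [[[? ?] [? ?]]|[[? ?] [? ?]]].
Qed.

(** This recovers [A] from its subgroup. *)
Lemma walk_conj_inHE A h a : h != 1 ->
  walk A 1 1 (inG a * inH h * (inG a)^-1) <-> A a.
Proof.
move=> h1; have wa B : walk B 1 a (inG a) by have := walk_inG B 1 a; rewrite mul1g.
split=> [/(walk_conj_inH h1)[b Ab wb]|Aa].
  by rewrite (walk_functional (wa A) wb).
by apply/(walk_conj _ (wa A)); apply: walk_inH.
Qed.

End Walks.

(** * The space of subgroups *)


Section SubgroupCoding.
Variable K : groupType.

Lemma subgroup_set_inj : injective (@subgroup_set K).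
Proof.
move=> A B e; apply: val_inj; apply/funext => g.
by apply: is_true_inj; exact: (congr1 (fun S : set K => S g) e).
Qed.

Lemma subgroup_set1 (A : @Sg K) : subgroup_set A 1.
Proof. by have [] := set_valP A. Qed.

Lemma subgroup_setV (A : @Sg K) x y :
  subgroup_set A x -> subgroup_set A y -> subgroup_set A (x / y).
Proof. by have [_ h] := set_valP A => Ax Ay; apply: (h x y). Qed.

Lemma subgroup_of_set (P : set K) : P 1 -> (forall x y, P x -> P y -> P (x / y)) ->
  exists A : @Sg K, subgroup_set A = P.
Proof.
move=> P1 PV; pose f : {ptws K -> bool} := fun g => `[< P g >].
have hf : Sg f.
  split; first exact/asboolP.
  by move=> x y /asboolP Px /asboolP Py; apply/asboolP; apply: PV.
exists (SigSub (mem_set hf)); apply/seteqP; split=> g; rewrite /subgroup_set /=.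
  by move/asboolP.
by move=> Pg; apply/asboolP.
Qed.


Variable phi : K -> nat.
Hypothesis phi_inj : injective phi.

(** Each subgroup condition involves at most three elements, so a good enough finite approximation
    decides it: the subgroups form a closed subset of [2^K]. *)
Lemma subgroup_limit (P : set K) :
  (forall n, exists A : @Sg K, forall g, (phi g < n)%N -> subgroup_set A g <-> P g) ->
  exists A : @Sg K, subgroup_set A = P.
Proof.
move=> hP; apply: subgroup_of_set.
  have [A hA] := hP (phi 1).+1; apply/(hA 1 (ltnSn _)); exact: subgroup_set1.
move=> x y Px Py.
have [A hA] := hP (maxn (maxn (phi x) (phi y)) (phi (x / y))).+1.
apply/hA; first by rewrite ltnS leq_maxr.
by apply: subgroup_setV; apply/hA => //; rewrite ltnS !leq_max leqnn ?orbT.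
Qed.

Definition index_in (A : set K) i := exists2 g, A g & phi g = i.

Lemma index_inP (A : set K) g : index_in A (phi g) <-> A g.
Proof. by split=> [[h Ah /phi_inj <-]|Ag]; last exists g. Qed.

Definition subgroup_code (A : @Sg K) : baire :=
  fun k => (`[< index_in (subgroup_set A) k >] : nat).

Lemma subgroup_code1 A k : subgroup_code A k = 1%N <-> index_in (subgroup_set A) k.
Proof.
by rewrite /subgroup_code; split=> [|/asboolT -> //]; case: asboolP.
Qed.

Lemma subgroup_code_inj : injective subgroup_code.
Proof.
move=> A B e; apply: subgroup_set_inj; apply/seteqP.
by split=> g Ag; apply/index_inP; rewrite -subgroup_code1; [rewrite -e|rewrite e];
  rewrite subgroup_code1; apply/index_inP.
Qed.

Lemma subgroup_code_closed z :
  (forall n, exists A, agree n (subgroup_code A) z) -> exists A, subgroup_code A = z.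
Proof.
move=> hz; have [n|A hA] := @subgroup_limit [set g | z (phi g) = 1%N].
  have [A hA] := hz n; exists A => g ltg /=.
  by rewrite -(hA _ ltg) subgroup_code1 index_inP.
exists A; apply/funext => k; have [B /(_ k (ltnSn k)) hB] := hz k.+1.
rewrite -hB /subgroup_code; congr (nat_of_bool _); apply/asbool_equiv_eq.
split=> -[g hg gk]; rewrite -gk index_inP.
  by apply/index_inP; rewrite -subgroup_code1 gk hB -gk; move: hg; rewrite hA.
by rewrite hA /= gk -hB subgroup_code1 -gk index_inP.
Qed.

Lemma borel_subgroup_mem g : borel_of subgroup_code [set A | subgroup_set A g].
Proof.
rewrite (_ : [set A | _] = [set A | subgroup_code A (phi g) = 1%N]).
  exact: borel_of_coord.
by apply/seteqP; split=> A /=; rewrite subgroup_code1 index_inP.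
Qed.

Lemma borel_code_preimage T (S : set (set T)) (psi : T -> @Sg K) :
  sigma_algebra setT S -> (forall g, S [set t | subgroup_set (psi t) g]) ->
  forall B, borel_of subgroup_code B -> S (psi @^-1` B).
Proof.
move=> hS bpsi B.
apply: (borel_of_sub (sigma_algebra_preimages psi hS)) => k i /=.
have [[g gk]|ng] := pselect (exists g, phi g = k); last first.
  rewrite (_ : psi @^-1` _ = [set _ | i = 0%N]); first exact: sigma_cst.
  apply/seteqP; split=> t /=; rewrite /subgroup_code.
    by case: asboolP => // -[g _ gk]; case: ng; exists g.
  by move=> ->; case: asboolP => // -[g _ gk]; case: ng; exists g.
rewrite (_ : psi @^-1` _ = [set t | (subgroup_set (psi t) g /\ i = 1%N) \/
    (~ subgroup_set (psi t) g /\ i = 0%N)]).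
  apply: (sigma_or hS); apply: (sigma_and hS) => //; try exact: sigma_cst.
  exact: (sigma_not hS).
apply/seteqP; split=> t /=; rewrite /subgroup_code -gk.
  case: asboolP => /index_inP h <-; [by left|by right; split=> // /index_inP].
by case=> -[h ->]; case: asboolP => // /index_inP.
Qed.

Lemma borel_subgroupsE : @borel_subgroups K = borel_of subgroup_code.
Proof.
apply/seteqP; split.
  apply: smallest_sub => // _ [V oV <-]; apply: borel_of_locally => A VA.
  (* [F] is generated by agreement with [A] on finite sets of indices. It converges pointwise, hence
     in the product topology, so one such agreement already forces membership in [V]. *)
  pose F := filter_from [set: nat] (fun n => [set h : {ptws K -> bool} |
    forall g, (phi g < n)%N -> h g = (val A : K -> bool) g]).
  have FF : Filter F.
    apply: filter_from_filter; first by exists 0%N.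
    move=> m n _ _; exists (maxn m n) => // h hh.
    by split=> g lt; apply: hh; rewrite leq_max lt ?orbT.
  have FA : F --> (val A : {ptws K -> bool}).
    apply/cvg_sup => g U [W [[D oD <-] DA] DU]; exists (phi g).+1 => // h hg.
    by apply: DU; rewrite /= hg.
  have [n _ hn] := FA _ (open_nbhs_nbhs (conj oV VA)).
  exists n => B agr; apply: hn => g lt /=; apply: is_true_inj; apply/propext.
  have := agr _ lt; have := index_inP (subgroup_set A) g.
  have := index_inP (subgroup_set B) g; rewrite -!subgroup_code1 => hB hAg e.
  by rewrite -[is_true _]/(subgroup_set B g) -hB -e hAg.
have bmem g : borel_subgroups [set A : @Sg K | subgroup_set A g].
  apply: sub_gen_smallest => /=.
  exists [set h : {ptws K -> bool} | h g]; last by [].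
  apply: (@open_comp _ _ (fun h : {ptws K -> bool} => h g) [set b | b]).
    by move=> h _; apply: (@proj_continuous K (fun _ => bool) g).
  exact: discrete_open.
move=> B bB; apply: (borel_code_preimage (psi := id) _ bmem bB).
exact: smallest_sigma_algebra.
Qed.

Lemma infinite_unbounded (A : set K) :
  infinite_set A <-> forall k, exists2 i, (k <= i)%N & index_in A i.
Proof.
split=> [infA k|unb].
  apply: contrapT => bdd; apply: infA.
  apply: (@sub_finite_set _ _ (phi @^-1` `I_k)).
    move=> g Ag /=; rewrite ltnNge; apply/negP => leg; apply: bdd.
    by exists (phi g) => //; exists g.
  by apply: finite_preimage => [? ? _ _|]; [exact: phi_inj|exact: finite_II].
move=> /(finite_image phi) /finite_seqP[s sE].
have [i lti [g Ag gi]] := unb (\max_(j <- s) j).+1.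
have : (phi @` A) i by exists g.
rewrite sE /= => si; have := @leq_bigmax_seq _ s xpredT id i si isT.
by rewrite leqNgt lti.
Qed.

Definition next_index (A : set K) k i :=
  [/\ (k <= i)%N, index_in A i & forall j, (k <= j < i)%N -> ~ index_in A j].

Lemma next_index_uniq A k i j : next_index A k i -> next_index A k j -> i = j.
Proof.
move=> [ki Ai mini] [kj Aj minj]; case: (ltngtP i j) => // lt.
  by case: (minj i) => //; rewrite ki.
by case: (mini j) => //; rewrite kj.
Qed.

Lemma next_index_self A k : next_index A k k <-> index_in A k.
Proof. by split=> [[]|Ak]; [|split=> // j; case: ltngtP; lia]. Qed.

(** A limit of infinite subgroups in [2^K] may be finite. Recording the next element after every [k]
    repairs this: each entry of a limit code names a member beyond [k], so the image is closed in
    the Baire space. *)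
Definition infinite_code (A : @infinite_subgroups K) : baire :=
  fun k => xget 0%N [set i | next_index (subgroup_set (val A)) k i].

Lemma infinite_codeP A k :
  next_index (subgroup_set (val A)) k (infinite_code A k).
Proof.
have [i ki Ai] := proj1 (infinite_unbounded (subgroup_set (val A))) (set_valP A) k.
have ex : exists i, (k <= i)%N && `[< index_in (subgroup_set (val A)) i >].
  by exists i; rewrite ki; apply/asboolP.
case: (ex_minnP ex) => m /andP[km /asboolP Am] min.
suff hm : next_index (subgroup_set (val A)) k m by apply: (xgetI 0%N hm).
split=> // j /andP[kj ltjm] /asboolP Aj.
by have := min j; rewrite kj Aj leqNgt ltjm => /(_ isT).
Qed.

Lemma infinite_code_index A k :
  infinite_code A k = k <-> index_in (subgroup_set (val A)) k.
Proof.
rewrite -next_index_self; split=> [e|h]; first by rewrite -{2}e; exact: infinite_codeP.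
exact: next_index_uniq (infinite_codeP A k) h.
Qed.

Lemma infinite_code_inj : injective infinite_code.
Proof.
move=> A B e; apply: val_inj; apply: subgroup_set_inj; apply/seteqP.
by split=> g Ag; apply/index_inP; rewrite -infinite_code_index; [rewrite -e|rewrite e];
  rewrite infinite_code_index; apply/index_inP.
Qed.

Lemma infinite_code_closed z :
  (forall n, exists A, agree n (infinite_code A) z) -> exists A, infinite_code A = z.
Proof.
move=> hz; have [n|A hA] := @subgroup_limit [set g | z (phi g) = phi g].
  have [A hA] := hz n; exists (val A) => g ltg /=.
  by rewrite -(hA _ ltg) infinite_code_index index_inP.
have memA i n B : agree n (infinite_code B) z -> (i < n)%N ->
    index_in (subgroup_set A) i <-> index_in (subgroup_set (val B)) i.
  move=> agr lti; split=> -[g hg gi]; rewrite -gi index_inP.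
    by move: hg; rewrite hA /= gi -agr // infinite_code_index -gi index_inP.
  by rewrite hA /= gi -agr // infinite_code_index -gi index_inP.
have nextA k : next_index (subgroup_set A) k (z k).
  have [B agr] := hz (maxn k (z k)).+1.
  have [kz Bz minB] : next_index (subgroup_set (val B)) k (z k).
    by rewrite -(agr k) ?ltnS ?leq_maxl //; exact: infinite_codeP.
  split=> //; first by apply/(memA _ _ _ agr) => //; rewrite ltnS leq_maxr.
  move=> j /andP[kj jz] /(memA _ _ _ agr) h; apply: (minB j); first by rewrite kj.
  by apply: h; rewrite ltnS leq_max (ltnW jz) orbT.
have infA : infinite_subgroups A.
  by apply/infinite_unbounded => k; have [kz Az _] := nextA k; exists (z k).
exists (SigSub (mem_set infA)); apply/funext => k.
exact: next_index_uniq (infinite_codeP (SigSub (mem_set infA)) k) (nextA k).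
Qed.

Lemma borel_infinite_subgroupsE : @borel_infinite_subgroups K = borel_of infinite_code.
Proof.
have bc k : borel_of infinite_code [set A | index_in (subgroup_set (val A)) k].
  rewrite (_ : [set A | _] = [set A | infinite_code A k = k]).
    exact: borel_of_coord.
  by apply/seteqP; split=> A /=; rewrite infinite_code_index.
apply/seteqP; split.
  move=> _ [B + <-]; rewrite setTI borel_subgroupsE; apply: borel_code_preimage => // g.
  rewrite (_ : [set A | _] = [set A | index_in (subgroup_set (val A)) (phi g)]) //.
  by apply/seteqP; split=> A /=; rewrite index_inP.
apply: borel_of_sub.
  exact/sigma_algebra_preimage/smallest_sigma_algebra.
move=> k i; exists [set A : @Sg K | next_index (subgroup_set A) k i]; last first.
  rewrite setTI; apply/seteqP; split=> A /=.
    exact: next_index_uniq (infinite_codeP A k).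
  by move=> <-; exact: infinite_codeP.
rewrite borel_subgroupsE; have bs j : borel_of subgroup_code
    [set A | index_in (subgroup_set A) j].
  rewrite (_ : [set A | _] = [set A | subgroup_code A j = 1%N]).
    exact: borel_of_coord.
  by apply/seteqP; split=> A /=; rewrite subgroup_code1.
rewrite (_ : [set A | _] = [set A | (k <= i)%N /\ (index_in (subgroup_set A) i /\
    forall j, (k <= j < i)%N -> ~ index_in (subgroup_set A) j)]).
  apply: (sigma_and (borel_of_sigma _)); first exact: (sigma_cst (borel_of_sigma _)).
  apply: (sigma_and (borel_of_sigma _)); first exact: bs.
  apply: (sigma_forall (borel_of_sigma _)) => j.
  apply: (sigma_imp (borel_of_sigma _)); first exact: (sigma_cst (borel_of_sigma _)).
  exact: (sigma_not (borel_of_sigma _)).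
by apply/seteqP; split=> A /=; [case|case=> ? []].
Qed.

End SubgroupCoding.


(** * Finite intersections of conjugates as a countable Borel quasi-order *)

Section ConjLe.
Variable K : groupType.
Implicit Types A B C : @Sg K.

Lemma conjugate_setE (g : K) (B : set K) x : conjugate_set g B x <-> B (g^-1 * x * g).
Proof.
split=> [[b Bb <-]|Bx]; first by rewrite -!mulgA mulVg mulg1 mulKg.
by exists (g^-1 * x * g) => //; rewrite !mulgA mulgV mul1g mulgK.
Qed.

Lemma conj_leP A B : conj_le A B <-> exists2 s : seq K, s != [::] &
  forall x, subgroup_set A x <-> forall g, g \in s -> subgroup_set B (g^-1 * x * g).
Proof.
split=> [[n [g [n1 AE]]]|[s s0 hs]].
  exists [seq g i | i <- enum 'I_n].
    by rewrite -size_eq0 size_map size_enum_ord -lt0n.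
  move=> x; rewrite AE; split=> [h _ /mapP[i _ ->]|h i _].
    by apply/conjugate_setE; apply: h.
  by apply/conjugate_setE; apply: h; apply: map_f; rewrite mem_enum.
exists (size s), (fun i => nth 1 s i); split; first by rewrite lt0n size_eq0.
apply/seteqP; split=> x.
  by move=> /hs h i _; apply/conjugate_setE; apply: h; apply: mem_nth.
move=> h; apply/hs => g gs; apply/conjugate_setE.
have gi : (index g s < size s)%N by rewrite index_mem.
by have := h (Ordinal gi) I; rewrite /= nth_index.
Qed.

Lemma conj_le_refl A : conj_le A A.
Proof.
apply/conj_leP; exists [:: 1] => // x.
split=> [Ax g|/(_ 1)]; first by rewrite inE => /eqP ->; rewrite invg1 mul1g mulg1.
by rewrite inE eqxx invg1 mul1g mulg1; apply.
Qed.

Lemma conj_le_trans A B C : conj_le A B -> conj_le B C -> conj_le A C.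
Proof.
move=> /conj_leP[s s0 hs] /conj_leP[t t0 ht]; apply/conj_leP.
exists [seq g * h | g <- s, h <- t].
  by case: s s0 {hs} => // g s _; case: t t0 {ht}.
move=> x; rewrite hs; split=> [h _ /allpairsP[[g k] /= [gs kt ->]]|h g gs].
  by have /ht/(_ k kt) := h g gs; rewrite invgM !mulgA.
by apply/ht => k kt; have := h _ (allpairs_f _ gs kt); rewrite invgM !mulgA.
Qed.

Hypothesis countableK : countable [set: K].

Lemma countable_group_index : exists phi : K -> nat, injective phi.
Proof.
have /countable_injP[phi h] := countableK; exists phi => x y e.
by apply: h => //; rewrite inE.
Qed.

(** A predecessor is determined by its finite list of conjugators, and there are countably many
    lists. The map [pi] serves [Sg] and its infinite members at once. *)
Lemma conj_le_countable Y (pi : Y -> @Sg K) (y : Y) :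
  injective pi -> countable [set x | conj_le (pi x) (pi y)].
Proof.
move=> pi_inj; have [phi phi_inj] := countable_group_index.
have /choice[s hs] : forall x, exists s : seq K, conj_le (pi x) (pi y) ->
    forall k, subgroup_set (pi x) k <->
      forall g, g \in s -> subgroup_set (pi y) (g^-1 * k * g).
  move=> x; have [/conj_leP[s _ hs]|nle] := pselect (conj_le (pi x) (pi y)).
    by exists s.
  by exists [::].
apply/countable_injP; exists (fun x => pickle (map phi (s x))) => x x'.
rewrite !inE => /= hx hx' /(pcan_inj pickleK)/(inj_map phi_inj) e.
apply: pi_inj; apply: subgroup_set_inj; apply/seteqP; split=> k.
  by move/(hs x hx); rewrite e => h; apply/(hs _ hx'); exact: h.
by move/(hs x' hx'); rewrite -e => h; apply/(hs _ hx); exact: h.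
Qed.

Lemma conj_le_borel Y (pi : Y -> @Sg K) (T : set (set Y)) :
  (forall g, T [set y | subgroup_set (pi y) g]) ->
  product_algebra T T [set p | conj_le (pi p.1) (pi p.2)].
Proof.
move=> bpi; have [phi phi_inj] := countable_group_index.
(* The default 1 is harmless: [psi] is onto [K], so quantifiers over [K] become quantifiers over
   [nat]. *)
pose psi n : K := xget 1 [set g | phi g = n].
have psiK g : psi (phi g) = g.
  by apply: phi_inj; rewrite /psi; case: xgetP => [h _ //|/(_ g) []].
have hS : sigma_algebra setT (product_algebra T T) by exact: smallest_sigma_algebra.
have b1 g : product_algebra T T [set p | subgroup_set (pi p.1) g].
  apply: sub_gen_smallest; left; exists [set y | subgroup_set (pi y) g] => //.
  by rewrite setTI.
have b2 g : product_algebra T T [set p | subgroup_set (pi p.2) g].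
  apply: sub_gen_smallest; right; exists [set y | subgroup_set (pi y) g] => //.
  by rewrite setTI.
rewrite (_ : [set p | _] = [set p | exists t : seq nat, t != [::] /\ forall n,
    subgroup_set (pi p.1) (psi n) <-> forall i, i \in t ->
      subgroup_set (pi p.2) ((psi i)^-1 * psi n * psi i)]).
  apply: (sigma_exists hS) => t; apply: (sigma_and hS); first exact: sigma_cst.
  apply: (sigma_forall hS) => n; apply: (sigma_iff hS); first exact: b1.
  apply: (sigma_forall hS) => i; apply: (sigma_imp hS); first exact: sigma_cst.
  exact: b2.
apply/seteqP; split=> p /=.
  move=> /conj_leP[s s0 hs]; exists (map phi s); split.
    by rewrite -size_eq0 size_map size_eq0.
  move=> n; rewrite hs; split=> [h _ /mapP[g gs ->]|h g gs].
    by rewrite psiK; apply: h.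
  by have := h (phi g) (map_f _ gs); rewrite psiK.
move=> [t [t0 ht]]; apply/conj_leP; exists (map psi t).
  by rewrite -size_eq0 size_map size_eq0.
move=> x; have := ht (phi x); rewrite psiK => ->.
split=> [h _ /mapP[i it ->]|h i it]; first exact: h.
by apply: h; apply: map_f.
Qed.

Lemma conj_le_countable_borel (R : realType) :
  countable_borel_quasi_order R (@borel_subgroups K) (@conj_le K).
Proof.
have [phi phi_inj] := countable_group_index.
split.
- rewrite (borel_subgroupsE phi_inj); apply: standard_borel_closed_image.
    exact: subgroup_code_inj.
  exact: subgroup_code_closed.
- exact: conj_le_refl.
- exact: conj_le_trans.
- apply: (@conj_le_borel _ id) => g.
  by rewrite (borel_subgroupsE phi_inj); apply: borel_subgroup_mem.
- by move=> B; apply: (@conj_le_countable _ id).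
Qed.

Lemma conj_le_infinite_countable_borel (R : realType) :
  countable_borel_quasi_order R (@borel_infinite_subgroups K) (@conj_le_infinite K).
Proof.
have [phi phi_inj] := countable_group_index.
split.
- rewrite (borel_infinite_subgroupsE phi_inj); apply: standard_borel_closed_image.
    exact: infinite_code_inj.
  exact: infinite_code_closed.
- by move=> A; apply: conj_le_refl.
- by move=> A B C; apply: conj_le_trans.
- apply: (@conj_le_borel _ val) => g.
  exists [set A : @Sg K | subgroup_set A g]; last by rewrite setTI.
  by rewrite (borel_subgroupsE phi_inj); apply: borel_subgroup_mem.
- by move=> B; apply: (@conj_le_countable _ val) => //; exact: val_inj.
Qed.

End ConjLe.

Lemma cyclic_countable (H : groupType) : cyclic_group H -> countable [set: H].
Proof.
move=> [h hH]; have /choice[n hn] : forall x : H, exists p : nat * bool,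
    x = if p.2 then h ^+ p.1 else h ^- p.1.
  by move=> x; have [n [->|->]] := hH x; [exists (n, true)|exists (n, false)].
apply/countable_injP; exists (pickle \o n) => x y _ _ /= /(pcan_inj pickleK) e.
by rewrite (hn x) (hn y) e.
Qed.

Lemma free_product_countable (G H : groupType) :
  countable [set: G] -> countable [set: H] -> countable [set: free_product G H].
Proof.
move=> /countable_group_index[i i_inj] /countable_group_index[j j_inj].
pose code (t : G + H) : nat + nat := match t with inl g => inl (i g) | inr h => inr (j h) end.
have code_inj : injective code by case=> [g|h] [g'|h'] //= [] => [/i_inj|/j_inj] ->.
apply/countable_injP; exists (fun x => pickle (map code (fp_word x))) => x y _ _.
by move=> /(pcan_inj pickleK)/(inj_map code_inj)/val_inj.
Qed.

(** * The reduction *)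


Section Reduction.
Variables G H : groupType.
Hypothesis nontrivialH : exists h : H, h != 1.
Local Notation K := (free_product G H).

Lemma walk_subgroup (A : set G) :
  exists B : @Sg K, subgroup_set B = [set x : K | walk A 1 1 (fp_word x)].
Proof.
apply: subgroup_of_set => // x y /= wx wy.
exact: (@walk_mul _ _ A 1 1 1 x y^-1 wx (walk_inv wy)).
Qed.

(** The subgroup generated by the conjugates of [H] by elements of [A], taken as closed walks so
    that membership is read off the word and is Borel in [A]. *)
Definition walk_group (A : set G) : @Sg K := projT1 (cid (walk_subgroup A)).

Lemma walk_groupE A (x : K) : subgroup_set (walk_group A) x <-> walk A 1 1 (fp_word x).
Proof. by rewrite /walk_group; case: cid => B /= ->. Qed.

Lemma walk_group_infinite A : infinite_set A -> infinite_subgroups (walk_group A).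
Proof.
have [h h1] := nontrivialH; apply: contra_not.
pose conj (a : G) : K := inG H a * inH G h * (inG H a)^-1.
move=> /(@finite_preimage _ _ _ conj) fin.
rewrite (_ : A = conj @^-1` (subgroup_set (walk_group A))).
  apply: fin => a b _ _ e.
  (* Injectivity of [conj] is tested in the subgroup of the singleton [[set a]], which contains the
     conjugate by [b] only when [b] is [a]. *)
  have : walk [set a] 1 1 (fp_word (conj b)) by rewrite -e; apply/walk_conj_inHE.
  by move/(walk_conj_inHE _ _ h1).
by apply/seteqP; split=> a /=; rewrite walk_groupE walk_conj_inHE.
Qed.

Lemma conj_le_walk_pair (A B : set G) p q :
  (forall r, A r <-> B (p * r) /\ B (q * r)) -> conj_le (walk_group A) (walk_group B).
Proof.
(* The set of [r] with [B (p * r)] is the translate of [B] by [p^-1], hence the inverse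
   conjugators. *)
move=> AB; apply/conj_leP; exists [:: (inG H p)^-1; (inG H q)^-1] => // x.
have conjE g : subgroup_set (walk_group B) ((inG H g)^-1^-1 * x * (inG H g)^-1) <->
    walk [set r | B (g * r)] 1 1 (fp_word x).
  rewrite walk_groupE invgK -walk_translate mulg1.
  by apply: walk_conj; have := walk_inG H B 1 g; rewrite mul1g.
rewrite walk_groupE (walk_and _ _ _ AB) -!conjE; split=> [[Bp Bq] g|h].
  by rewrite !inE => /orP[]/eqP ->.
by split; apply: h; rewrite !inE eqxx ?orbT.
Qed.

(** Every conjugate in the intersection contains the group of the nonempty [A], so it is the group
    of a translate of [B]; testing the conjugates [a h a^-1] turns the intersection of groups into
    one of sets. *)
Lemma conj_le_walk_group (A B : set G) : A !=set0 ->
  conj_le (walk_group A) (walk_group B) ->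
  exists s : seq G, forall a, A a <-> forall g, g \in s -> B (g * a).
Proof.
move=> A0 /conj_leP[s _ hs].
have [h h1] := nontrivialH.
have /choice[t ht] : forall x, exists g, x \in s -> forall y : K,
    walk B 1 1 (fp_word (x^-1 * y * x)) <-> walk [set r | B (g * r)] 1 1 (fp_word y).
  move=> x; have [xs|nxs] := boolP (x \in s); last by exists 1.
  have [|y wy|g hg] := @conj_walk_translate G H A B x _ A0; first exact: nontrivialH.
    by have := proj1 (hs y) ((walk_groupE _ _).2 wy) x xs; rewrite walk_groupE.
  by exists g.
exists (map t s) => a.
rewrite -(walk_conj_inHE _ _ h1) -walk_groupE hs.
split=> [hw _ /mapP[x xs ->]|hw x xs].
  by have := hw x xs; rewrite walk_groupE ht // walk_conj_inHE.
by rewrite walk_groupE ht // walk_conj_inHE //; apply: hw; apply: map_f.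
Qed.

Lemma borel_walk T (S : set (set T)) (A : T -> set G) p q (w : seq (G + H)) :
  sigma_algebra setT S -> (forall g, S [set t | A t g]) ->
  S [set t | walk (A t) p q w].
Proof.
move=> hS bA; elim: w p => [|[g|h] w IH] p /=; first exact: sigma_cst.
  exact: IH.
exact: (sigma_and hS).
Qed.

End Reduction.

(** One map with infinite values serves both relations. Its measurability is stated after [val],
    since the Borel structure on infinite subgroups is the induced one. *)
Lemma conj_le_universal_reduction (R : realType) (G H : groupType)
    (X : Type) (S : set (set X)) (Q : X -> X -> Prop) :
  countable [set: free_product G H] ->
  has_nonabelian_free_subgroup G -> (exists h : H, h != 1) ->
  countable_borel_quasi_order R S Q ->
  exists theta : X -> @infinite_subgroups (free_product G H),
    borel_map S (@borel_subgroups (free_product G H)) (val \o theta) /\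
    forall x y, Q x y <-> conj_le (val (theta x)) (val (theta y)).
Proof.
move=> cK freeG ntH cbQ; have [_ Qxx _ _ _] := cbQ.
have [c [P [f [SE bf Ptr PE QP]]]] := quasi_order_borel_funs cbQ.
have [gen gen_inj gen_red] := free_pair freeG.
have quot := word_val_quotient_inj gen_inj gen_red.
have inj := word_val_inj gen_inj gen_red.
pose A x := tree_set f gen (c x).
have infA x : infinite_subgroups (walk_group H (A x)).
  by apply: walk_group_infinite => //; apply: tree_set_infinite.
exists (fun x => SigSub (mem_set (infA x))); split=> [B|x y] /=.
  have [phi phi_inj] := countable_group_index cK.
  rewrite (borel_subgroupsE phi_inj) SE; apply: borel_code_preimage => // g /=.
  rewrite (_ : [set x | _] = [set x | walk (A x) 1 1 (fp_word g)]).
    apply: borel_walk => // a; apply: borel_tree_set => //.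
    by move=> k i; apply: borel_of_coord.
  by apply/seteqP; split=> x /=; rewrite walk_groupE.
rewrite QP; split=> [/PE[n e]|le].
  apply: (@conj_le_walk_pair _ _ _ _ (word_val gen (letter_code (Some n)))
    (word_val gen (letter_code None))) => r.
  by rewrite /A e; apply: tree_set_step.
have [|s hs] := conj_le_walk_group ntH _ le.
  by apply: infinite_setN0; apply: tree_set_infinite.
have [t ->] := tree_set_inter quot inj hs.
have Py : P (c y) (c y) by apply/QP.
(* Each application of some [f n] goes down in [P], so the iterate stays below [c y]; [Py] covers
   the empty iterate. *)
elim/last_ind: t => // t n; apply: Ptr.
by rewrite foldl_rcons; apply/PE; exists n.
Qed.

Local Close Scope group_scope.

Theorem theorem4p12 (R : realType) (G H : groupType)
    (countableG : countable [set: G])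
    (freeG : has_nonabelian_free_subgroup G)
    (cyclicH : cyclic_group H)
    (nontrivialH : nontrivial_group H) :
  universal_countable_borel_quasi_order R
    (@borel_infinite_subgroups (free_product G H))
    (@conj_le_infinite (free_product G H)) /\
  universal_countable_borel_quasi_order R
    (@borel_subgroups (free_product G H))
    (@conj_le (free_product G H)).
Proof.
have cK := free_product_countable countableG (cyclic_countable cyclicH).
have ntH : exists h : H, (h != 1)%g.
  by have [h /eqP h1] := nontrivialH; exists h.
split; split.
- exact: conj_le_infinite_countable_borel.
- move=> X S Q cbQ.
  have [theta [btheta hQ]] := conj_le_universal_reduction cK freeG ntH cbQ.
  by exists theta; split=> // _ [B /btheta bB <-]; rewrite setTI.
- exact: conj_le_countable_borel.
- move=> X S Q cbQ.
  have [theta [btheta hQ]] := conj_le_universal_reduction cK freeG ntH cbQ.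
  by exists (val \o theta).
Qed.
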